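(* Let $p$ be a prime and let $a_2,a_3,b_2,b_3$ be nonzero elements of the field $\mathbb{Q}_p$ of $p$-adic numbers. Let $\xi_1,\xi_2,\xi_3,\xi_4$ be independent $\mathbb{Q}_p$-valued random variables with nowhere-vanishing characteristic functions, and put $L_1=\xi_1+a_2\xi_2+a_3\xi_3$, $L_2=b_2\xi_2+b_3\xi_3+\xi_4$. For independent $\mathbb{Q}_p$-valued random variables $\eta_1,\dots,\eta_4$ with nowhere-vanishing characteristic functions put $M_1=\eta_1+a_2\eta_2+a_3\eta_3$, $M_2=b_2\eta_2+b_3\eta_3+\eta_4$. (I) If $a_2b_3\neq a_3b_2$, then for every such $\eta_1,\dots,\eta_4$ with $(M_1,M_2)$ equal in distribution to $(L_1,L_2)$, there exist $\alpha_1,\dots,\alpha_4\in\mathbb{Q}_p$ such that $\eta_j$ has the same distribution as $\xi_j+\alpha_j$ for $j=1,2,3,4$. (II) If $a_2b_3=a_3b_2$, $|a_2|_p\neq|a_3|_p$, and $\xi_2,\xi_3$ are identically distributed, then for every such $\eta_1,\dots,\eta_4$ with $\eta_2,\eta_3$ identically distributed and $(M_1,M_2)$ equal in distribution to $(L_1,L_2)$, there exist $\alpha_1,\dots,\alpha_4\in\mathbb{Q}_p$ such that $\eta_j$ has the same distribution as $\xi_j+\alpha_j$ for $j=1,2,3,4$.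
   Context: $|\cdot|_p$ denotes the $p$-adic norm on $\mathbb{Q}_p$. The additive group of $\mathbb{Q}_p$ is a locally compact Abelian group whose character group is topologically isomorphic to $\mathbb{Q}_p$; write $(x,y)$ for the value of the character $y$ at $x$, with $(ax,y)=(x,ay)$ for $a,x,y\in\mathbb{Q}_p$. The characteristic function of a $\mathbb{Q}_p$-valued random variable $\xi$ with distribution $\mu$ is $\hat\mu(y)=\mathbf{E}[(\xi,y)]=\int_{\mathbb{Q}_p}(x,y)\,d\mu(x)$, $y$ in the character group; ''nowhere-vanishing'' means $\hat\mu(y)\neq0$ for all $y$. *)

(* Defs.v *)
From HB Require Import structures.
From mathcomp Require Import all_boot all_order all_algebra.
From mathcomp Require Import all_classical all_reals all_analysis.
Set Implicit Arguments. Unset Strict Implicit. Unset Printing Implicit Defensive.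
Import Order.TTheory GRing.Theory Num.Theory.
Local Open Scope classical_set_scope.
Local Open Scope ring_scope.

(* The field Q_p of p-adic numbers, realised as the inverse limit           *)
(*   Q_p  =  lim_n  Z[1/p] / p^n Z   ( = lim_n Q_p / p^n Z_p ).             *)
(* An element x is the sequence (x_n)_n of canonical representatives        *)
(* x_n in Z[1/p] cap [0, p^n) of x modulo p^n Z_p, with x_n = x_{n+1}       *)
(* modulo p^n.  In particular x_0 = {x}_p is the p-adic fractional part.    *)

Definition rmod (r m : rat) : rat := r - (Num.floor (r / m))%:~R * m.

Definition inZp1 (p : nat) (r : rat) : Prop :=
  exists k : nat, (r * (p%:R ^+ k)) \is a Num.int.

Definition validQp (p : nat) (f : nat -> rat) : Prop :=
  forall n : nat, inZp1 p (f n) /\ rmod (f n.+1) (p%:R ^+ n) = f n.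

Record Qp (p : nat) := MkQp { qseq : nat -> rat; qvalid : validQp p qseq }.

Lemma validQp0 (p : nat) : validQp p (fun _ => 0).
Proof.
move=> n; split; first by exists 0%N; rewrite mul0r.
by rewrite /rmod mul0r floor0 mul0r subr0.
Qed.

Definition qzero (p : nat) : Qp p := @MkQp p (fun _ => 0) (validQp0 p).

HB.instance Definition _ (p : nat) := gen_eqMixin (Qp p).
HB.instance Definition _ (p : nat) := gen_choiceMixin (Qp p).
HB.instance Definition _ (p : nat) := isPointed.Build (Qp p) (qzero p).

(* Packs a sequence into Q_p; all sequences to which it is applied below are *)
(* valid whenever the inputs are, so the default value is never used.      *)
Definition mkQp (p : nat) (f : nat -> rat) : Qp p :=
  match pselect (validQp p f) with
  | left H => MkQp H
  | right _ => qzero p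
  end.

Definition qadd (p : nat) (x y : Qp p) : Qp p :=
  mkQp p (fun n => rmod (qseq x n + qseq y n) (p%:R ^+ n)).

(* exponent of p in the denominator of {x}_p, so that p^(dexp x) x_n is an integer *)
Definition dexp (p : nat) (x : Qp p) : nat := logn p `|denq (qseq x 0)|.

Definition qmul (p : nat) (x y : Qp p) : Qp p :=
  mkQp p (fun n => rmod (qseq x (n + dexp x + dexp y)%N * qseq y (n + dexp x + dexp y)%N)
                        (p%:R ^+ n)).

Definition qfrac (p : nat) (x : Qp p) : rat := qseq x 0.

Definition qnorm (p : nat) (x : Qp p) : rat :=
  if qseq x 0 != 0 then (denq (qseq x 0))%:~R
  else match pselect (exists n : nat, qseq x n.+1 != 0) with
       | left H => (p%:R ^- ex_minn H)
       | right _ => 0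
       end.

(* Borel sigma-algebra of Q_p: generated by the balls x + p^n Z_p (n >= 0), *)
(* i.e. the sets {x | x_n = r}; every open set of Q_p is a countable union  *)
(* of such balls.                                                          *)
Definition qballs (p : nat) : set (set (Qp p)) :=
  [set A | exists (n : nat) (r : rat), A = [set x | qseq x n = r]].

Definition QpM (p : nat) := g_sigma_algebraType (@qballs p).

Definition qchar_re (R : realType) (p : nat) (x y : Qp p) : R :=
  cos (2 * pi * ratr (qfrac (qmul x y))).
Definition qchar_im (R : realType) (p : nat) (x y : Qp p) : R :=
  sin (2 * pi * ratr (qfrac (qmul x y))).

Section prob_defs.
Context (R : realType) (p : nat).

Definition same_law {dV : measure_display} {W : measurableType dV}
  {d d' : measure_display} {T : measurableType d} {T' : measurableType d'}
  (P : probability T R) (X : T -> W) (P' : probability T' R) (Y : T' -> W) : Prop :=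
  forall A : set W, measurable A -> P (X @^-1` A) = P' (Y @^-1` A).

Definition indep4 {d : measure_display} {T : measurableType d} (P : probability T R)
  (X1 X2 X3 X4 : T -> QpM p) : Prop :=
  forall A1 A2 A3 A4 : set (QpM p),
    measurable A1 -> measurable A2 -> measurable A3 -> measurable A4 ->
    P (X1 @^-1` A1 `&` X2 @^-1` A2 `&` X3 @^-1` A3 `&` X4 @^-1` A4) =
    (P (X1 @^-1` A1) * P (X2 @^-1` A2) * P (X3 @^-1` A3) * P (X4 @^-1` A4))%E.

Definition charfun_nonvanishing {d : measure_display} {T : measurableType d}
  (P : probability T R) (X : T -> QpM p) : Prop :=
  forall y : Qp p,
    (\int[P]_t (qchar_re R (X t) y)%:E)%E <> 0%E \/
    (\int[P]_t (qchar_im R (X t) y)%:E)%E <> 0%E.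

End prob_defs.

(* Main.v *)
(** Let [f_j] be the quotient of the characteristic functions of [eta_j] and
    [xi_j].  Equality of the laws of [(M_1, M_2)] and [(L_1, L_2)] means
    [f_1(u) f_2(a_2 u + b_2 v) f_3(a_3 u + b_3 v) f_4(v) = 1] for all [u], [v].

    In case (I) the third differences of every [f_j] are trivial.  Hence
    [f(x + y) / (f(x) f(y))] is bimultiplicative; it is positive because
    [f(-x)] is the conjugate of [f(x)] and [Q_p] is divisible by [2], and it is [1]
    because [p^k y] tends to [0].  In case (II) the function
    [G(w) = f_2(a_2 w) f_2(a_3 w)] is multiplicative; dividing [f_2] by a suitable
    character gives [k] with [k(w) k(r w) = 1] and [|r|_p < 1], so
    [k(w) = k(r^(2 n) w)], which tends to [k(0) = 1].

    In both cases every [f_j] is a continuous character of [Q_p], hence of the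
    form [y |-> (alpha_j, y)], and characteristic functions determine laws. *)

Require Import Defs.
From HB Require Import structures.
From mathcomp Require Import all_boot all_order all_algebra.
From mathcomp Require Import all_classical all_reals all_analysis.
From mathcomp Require Import measurable_realfun complex ring lra zify.
Import Order.TTheory GRing.Theory Num.Theory.
Local Open Scope classical_set_scope.
Local Open Scope ring_scope.
Import numFieldNormedType.Exports.
Set Implicit Arguments. Unset Strict Implicit. Unset Printing Implicit Defensive.

(** * The topological field of p-adic numbers *)

(** In case (I) the forms [u], [a_2 u + b_2 v], [a_3 u + b_3 v], [v] are pairwise independent.
    Moving [(u, v)] along the kernel of one form leaves its factor unchanged, so three moves, one
    for each of the other forms, eliminate everything except the chosen [f_j]. In case (II) the two
    middle forms are proportional and only the product [f_2(a_2 w) f_3(a_3 w)] is visible; identical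
    distribution gives [f_2 = f_3], and the unequal norms make one of the two dilations a
    contraction relative to the other.

    A quotient of characteristic functions need not be positive definite, so the arguments about
    [f_j] use only its value at [0], hermitian symmetry, nonvanishing and continuity.

    The measure theory stays elementary because, for fixed [y], the character [x |-> (x, y)] depends
    only on one coordinate [x_n]. The expectations of characters are thus expectations of functions
    of countable-valued variables, and independence, equality in law and continuity all reduce to
    indicators of levels and to sequences that are stationary at each point. *)

Section PadicCongruence.
Variables (p : nat) (hp : prime p).

(** On [Z[1/p]] this is congruence modulo [p^n Z_p], since an element of [Z[1/p]] that lies in [Z_p]
    is an integer. *)
Definition eqmp (n : nat) (r s : rat) : Prop := (r - s) / p%:R ^+ n \is a Num.int.

Lemma pX_neq0 n : (p%:R ^+ n : rat) != 0.
Proof. by rewrite expf_neq0 // pnatr_eq0 -lt0n prime_gt0. Qed.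
Let pXn0 := pX_neq0.

Lemma pX_int n : (p%:R ^+ n : rat) \is a Num.int.
Proof. by rewrite rpredX // natr_int. Qed.

Lemma eqmp_refl n r : eqmp n r r.
Proof. by rewrite /eqmp subrr mul0r. Qed.

Lemma eqmp_sym n r s : eqmp n r s -> eqmp n s r.
Proof. by rewrite /eqmp -(opprB s r) mulNr rpredN. Qed.

Lemma eqmp_trans n s r t : eqmp n r s -> eqmp n s t -> eqmp n r t.
Proof.
rewrite /eqmp => rs st; have -> : r - t = (r - s) + (s - t) by ring.
by rewrite mulrDl rpredD.
Qed.

Lemma eqmp_le m n r s : (m <= n)%N -> eqmp n r s -> eqmp m r s.
Proof.
rewrite /eqmp => mn rs.
have -> : (r - s) / p%:R ^+ m = (r - s) / p%:R ^+ n * p%:R ^+ (n - m) :> rat.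
  rewrite -{1}(subnK mn) addnC exprD; field.
  by rewrite !pXn0.
by rewrite rpredM ?pX_int.
Qed.

Lemma eqmpD n r r' s s' : eqmp n r r' -> eqmp n s s' -> eqmp n (r + s) (r' + s').
Proof.
rewrite /eqmp => h k; have -> : r + s - (r' + s') = (r - r') + (s - s') by ring.
by rewrite mulrDl rpredD.
Qed.

Lemma eqmpN n r s : eqmp n r s -> eqmp n (- r) (- s).
Proof. by rewrite /eqmp -opprD mulNr rpredN. Qed.

(** From [r s - r' s' = r (s - s') + s' (r - r')]: a denominator [p^d] in one factor costs [d]
    digits of precision in the other. *)
Lemma eqmpM n d d' r r' s s' :
  r * p%:R ^+ d \is a Num.int -> s' * p%:R ^+ d' \is a Num.int ->
  eqmp (n + d') r r' -> eqmp (n + d) s s' -> eqmp n (r * s) (r' * s').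
Proof.
rewrite /eqmp => rd sd rr ss.
have -> : (r * s - r' * s') / p%:R ^+ n =
   (r * p%:R ^+ d) * ((s - s') / p%:R ^+ (n + d)) +
   (s' * p%:R ^+ d') * ((r - r') / p%:R ^+ (n + d')) :> rat.
  by rewrite !exprD; field; rewrite !pXn0.
by rewrite rpredD // rpredM.
Qed.

Lemma rmod_eqmp n r : eqmp n (rmod r (p%:R ^+ n)) r.
Proof.
rewrite /eqmp /rmod; set k := Num.floor _.
by rewrite addrC addKr mulNr mulfK ?pXn0 // rpredN intr_int.
Qed.

Lemma eqmp_rmod n r s : eqmp n r s -> rmod r (p%:R ^+ n) = rmod s (p%:R ^+ n).
Proof.
rewrite /eqmp => rs; rewrite /rmod.
have -> : r / p%:R ^+ n = (r - s) / p%:R ^+ n + s / p%:R ^+ n by ring.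
rewrite floorDzr // rmorphD /=.
move: rs; rewrite intrEfloor => /eqP ->.
set z := (Num.floor (s / _))%:~R; field.
by rewrite pXn0.
Qed.

Lemma rmod_rmod n r : rmod (rmod r (p%:R ^+ n)) (p%:R ^+ n) = rmod r (p%:R ^+ n).
Proof. exact/eqmp_rmod/rmod_eqmp. Qed.

Lemma inZp1D r s : inZp1 p r -> inZp1 p s -> inZp1 p (r + s).
Proof.
move=> [k hk] [l hl]; exists (k + l)%N.
rewrite exprD; have -> : (r + s) * (p%:R ^+ k * p%:R ^+ l) =
  r * p%:R ^+ k * p%:R ^+ l + s * p%:R ^+ l * p%:R ^+ k by ring.
by rewrite rpredD // rpredM ?pX_int.
Qed.

Lemma inZp1N r : inZp1 p r -> inZp1 p (- r).
Proof. by move=> [k hk]; exists k; rewrite mulNr rpredN. Qed.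

Lemma inZp1M r s : inZp1 p r -> inZp1 p s -> inZp1 p (r * s).
Proof. by move=> [k hk] [l hl]; exists (k + l)%N; rewrite exprD mulrACA rpredM. Qed.

Lemma inZp1_int r : r \is a Num.int -> inZp1 p r.
Proof. by move=> h; exists 0%N; rewrite mulr1. Qed.

Lemma inZp1_divX r n : r \is a Num.int -> inZp1 p (r / p%:R ^+ n).
Proof. by move=> h; exists n; rewrite divfK ?pXn0. Qed.

Lemma inZp1_rmod r n : inZp1 p r -> inZp1 p (rmod r (p%:R ^+ n)).
Proof.
move=> h; rewrite /rmod; apply: inZp1D => //; apply: inZp1N; apply: inZp1M.
  exact/inZp1_int/intr_int.
exact/inZp1_int/pX_int.
Qed.

Lemma Qp_ext (x y : Qp p) : qseq x =1 qseq y -> x = y.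
Proof.
case: x y => [f hf] [g hg] /= /funext fg; subst g.
by congr MkQp; apply: Prop_irrelevance.
Qed.

Lemma inZp1_qseq (x : Qp p) n : inZp1 p (qseq x n).
Proof. by case: (qvalid x n). Qed.

Lemma rmod_qseq (x : Qp p) n : rmod (qseq x n) (p%:R ^+ n) = qseq x n.
Proof. by case: (qvalid x n) => _ <-; exact: rmod_rmod. Qed.

Lemma eqmp_qseq (x : Qp p) m n : (n <= m)%N -> eqmp n (qseq x m) (qseq x n).
Proof.
move=> /subnK <-; elim: (m - n)%N => [|k IH]; first exact: eqmp_refl.
apply: eqmp_trans IH; rewrite addSn; apply: (@eqmp_le _ (k + n)%N); first by rewrite leq_addl.
case: (qvalid x (k + n)%N) => _ <-; exact/eqmp_sym/rmod_eqmp.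
Qed.

Lemma eqmp_qseq_eq (x y : Qp p) n : eqmp n (qseq x n) (qseq y n) -> qseq x n = qseq y n.
Proof. by move=> h; rewrite -rmod_qseq -[RHS]rmod_qseq; exact: eqmp_rmod. Qed.

Lemma mkQp_qseq (f : nat -> rat) : validQp p f -> qseq (mkQp p f) = f.
Proof. by move=> h; rewrite /mkQp; case: pselect. Qed.

(** Limit of a sequence in [Z[1/p]] with [c_(n+1)] congruent to [c_n] modulo [p^n]. Both [qadd] and
    [qmul] are of this form by conversion. *)
Definition qlim (c : nat -> rat) : Qp p := mkQp p (fun n => rmod (c n) (p%:R ^+ n)).

Lemma qlim_qseq (c : nat -> rat) n :
  (forall n, inZp1 p (c n)) -> (forall n, eqmp n (c n.+1) (c n)) ->
  qseq (qlim c) n = rmod (c n) (p%:R ^+ n).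
Proof.
move=> h1 h2; rewrite /qlim mkQp_qseq // => m; split; first exact: inZp1_rmod.
apply: eqmp_rmod; apply: eqmp_trans (h2 m).
apply: eqmp_le (rmod_eqmp m.+1 _) => //.
Qed.

(* [s] converges to [x].  Sums and products of approximations approximate sums and
   products, so the ring axioms of [Q_p] follow from those of [rat] by [approx_uniq]. *)
Definition approx (s : nat -> rat) (x : Qp p) : Prop :=
  forall n, exists N0, forall N, (N0 <= N)%N -> eqmp n (s N) (qseq x n).

Lemma approx_qseq (x : Qp p) : approx (qseq x) x.
Proof. by move=> n; exists n => N; exact: eqmp_qseq. Qed.

Lemma approx_uniq s (x y : Qp p) : approx s x -> approx s y -> x = y.
Proof.
move=> hx hy; apply: Qp_ext => n; have [N0 h0] := hx n; have [N1 h1] := hy n.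
apply: eqmp_qseq_eq; apply: (@eqmp_trans _ (s (maxn N0 N1))).
  by apply/eqmp_sym/h0; exact: leq_maxl.
by apply/h1; exact: leq_maxr.
Qed.

Lemma approx_qlim c : (forall n, inZp1 p (c n)) -> (forall n, eqmp n (c n.+1) (c n)) ->
  approx c (qlim c).
Proof.
move=> h1 h2 n; exists n => N nN; rewrite qlim_qseq //.
apply: (@eqmp_trans _ (c n)); last exact/eqmp_sym/rmod_eqmp.
move: nN => /subnK <-; elim: (N - n)%N => [|k IH]; first exact: eqmp_refl.
apply: eqmp_trans IH; rewrite addSn; apply: eqmp_le (h2 (k + n)%N); exact: leq_addl.
Qed.

Lemma approxD s t (x y : Qp p) : approx s x -> approx t y ->
  approx (fun n => s n + t n) (qadd x y).
Proof.
move=> hx hy n; have [N0 h0] := hx n; have [N1 h1] := hy n.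
exists (maxn N0 N1) => N; rewrite geq_max => /andP[/h0 k0 /h1 k1].
rewrite [qadd x y]/(qlim (fun n => qseq x n + qseq y n)) qlim_qseq; first last.
- by move=> m; apply: eqmpD; exact: eqmp_qseq.
- by move=> m; apply: inZp1D; exact: inZp1_qseq.
apply: eqmp_trans (eqmp_sym (rmod_eqmp _ _)); exact: eqmpD.
Qed.

Definition qopp (x : Qp p) := qlim (fun n => - qseq x n).

Lemma approxN s (x : Qp p) : approx s x -> approx (fun n => - s n) (qopp x).
Proof.
move=> hx n; have [N0 h0] := hx n; exists N0 => N /h0 k0.
rewrite qlim_qseq; first last.
- by move=> m; apply: eqmpN; exact: eqmp_qseq.
- by move=> m; apply: inZp1N; exact: inZp1_qseq.
by apply: eqmp_trans (eqmp_sym (rmod_eqmp _ _)); exact: eqmpN.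
Qed.

(** The embedding of [Z[1/p]] into [Q_p]; on other rationals [mkQp] falls back to its default
    value. *)
Definition qrat (r : rat) : Qp p := qlim (fun _ => r).

Lemma qrat_qseq r n : inZp1 p r -> qseq (qrat r) n = rmod r (p%:R ^+ n).
Proof. by move=> h; rewrite qlim_qseq // => m; exact: eqmp_refl. Qed.

Lemma approx_qrat r : inZp1 p r -> approx (fun _ => r) (qrat r).
Proof. by move=> h; apply: approx_qlim => // m; exact: eqmp_refl. Qed.

Lemma approx_qzero : approx (fun _ => 0) (qzero p).
Proof. by move=> n; exists 0%N => N _; exact: eqmp_refl. Qed.

(** The denominator is prime to the numerator, so it divides any [p^k] that clears it. This makes
    [dexp] the exact exponent of the denominator of [x_0]. *)
Lemma denq_inZp1 r : inZp1 p r -> `|denq r|%N = (p ^ logn p `|denq r|)%N.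
Proof.
move=> [k /intrP[m hm]].
have dv : (`|denq r| %| p ^ k)%N.
  have pz : (p ^ k)%:R = (p%:Z ^+ k)%:~R :> rat by rewrite natrX rmorphXn.
  have : numq r * p%:Z ^+ k = m * denq r.
    apply/eqP; rewrite -(eqr_int rat) !rmorphM /= -hm rmorphXn /=.
    by rewrite mulrAC -{2}(divq_num_den r) divfK // intr_eq0 denq_neq0.
  move=> /(congr1 absz); rewrite !abszM abszX /= => e.
  have : (`|denq r| %| `|numq r| * p ^ k)%N by rewrite e dvdn_mull.
  by rewrite Gauss_dvdr // coprime_sym coprime_num_den.
have [i _ ->] := dvdn_pfactor _ _ hp dv.
by rewrite pfactorK.
Qed.

(** All [x_n] differ from [x_0] by integers, so the denominator of [x_0] serves for every [n]. *)
Lemma dexpP (x : Qp p) n : qseq x n * p%:R ^+ dexp x \is a Num.int.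
Proof.
have h0 : qseq x 0 * p%:R ^+ dexp x \is a Num.int.
  rewrite -natrX /dexp -denq_inZp1; last exact: inZp1_qseq.
  have -> : (`|denq (qseq x 0)|%N)%:R = (denq (qseq x 0))%:~R :> rat.
    by rewrite -[in RHS](gez0_abs (denq_ge0 _)).
  by rewrite -{1}(divq_num_den (qseq x 0)) divfK ?intr_int // intr_eq0 denq_neq0.
have := eqmp_qseq x (leq0n n); rewrite /eqmp expr0 divr1 => h.
rewrite -(subrK (qseq x 0) (qseq x n)) mulrDl rpredD // rpredM ?pX_int //.
Qed.

Lemma approxM s t (x y : Qp p) : approx s x -> approx t y ->
  approx (fun n => s n * t n) (qmul x y).
Proof.
move=> hx hy n; set A := (n + dexp x + dexp y)%N.
have [N0 h0] := hx A; have [N1 h1] := hy A.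
exists (maxn N0 N1) => N; rewrite geq_max => /andP[/h0 k0 /h1 k1].
rewrite [qmul x y]/(qlim (fun n => qseq x (n + dexp x + dexp y)%N * qseq y (n + dexp x + dexp y)%N)).
rewrite qlim_qseq; first last.
- move=> m; apply: (@eqmpM _ (dexp x) (dexp y)); rewrite ?dexpP //.
  + by apply: (@eqmp_le _ (m + dexp x + dexp y)); [lia|apply: eqmp_qseq; lia].
  + by apply: (@eqmp_le _ (m + dexp x + dexp y)); [lia|apply: eqmp_qseq; lia].
- by move=> m; apply: inZp1M; exact: inZp1_qseq.
apply: eqmp_trans (eqmp_sym (rmod_eqmp _ _)); rewrite -/A.
apply: eqmp_sym; apply: (@eqmpM _ (dexp x) (dexp y)); rewrite ?dexpP //.
(* The approximation [t N] is congruent to [y_A] modulo [1], so it inherits the denominator bound of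
   [y]. *)
- have := eqmp_le (leq_addl (n + dexp x)%N (dexp y)) k1.
  move=> h; have k1' := eqmp_le (leq0n A) k1.
  move: k1'; rewrite /eqmp expr0 divr1 => q.
  rewrite -(subrK (qseq y A) (t N)) mulrDl rpredD ?dexpP // rpredM ?pX_int //.
- by apply: eqmp_le (eqmp_sym k0); rewrite /A; lia.
- by apply: eqmp_le (eqmp_sym k1); rewrite /A; lia.
Qed.

End PadicCongruence.

(* Carries the primality proof, so that the field structure can be inferred from the type. *)
Definition Qpf (p : nat) (hp : prime p) : Type := Qp p.

(** * Ring and field structure of [Q_p], smallness and the norm *)

Section PadicRing.
Variables (p : nat) (hp : prime p).
Local Notation K := (Qpf hp).

HB.instance Definition _ := gen_eqMixin K.
HB.instance Definition _ := gen_choiceMixin K.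

Local Notation ax := (approx_qseq hp).

Lemma qaddA : associative (@qadd p).
Proof.
move=> x y z; apply: (approx_uniq hp (approxD hp (ax x) (approxD hp (ax y) (ax z)))).
under [fun n => _]eq_fun do rewrite addrA.
exact: (approxD hp (approxD hp (ax x) (ax y)) (ax z)).
Qed.

Lemma qaddC : commutative (@qadd p).
Proof.
move=> x y; apply: (approx_uniq hp (approxD hp (ax x) (ax y))).
under [fun n => _]eq_fun do rewrite addrC.
exact: (approxD hp (ax y) (ax x)).
Qed.

Lemma qadd0 : left_id (qzero p) (@qadd p).
Proof.
move=> x; apply: (approx_uniq hp (approxD hp (approx_qzero p) (ax x))).
by under [fun n => _]eq_fun do rewrite add0r; exact: ax.
Qed.

Lemma qaddN : left_inverse (qzero p) (@qopp p) (@qadd p).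
Proof.
move=> x; apply: (approx_uniq hp (approxD hp (approxN hp (ax x)) (ax x))).
by under [fun n => _]eq_fun do rewrite addNr; exact: approx_qzero.
Qed.

HB.instance Definition _ := GRing.isZmodule.Build K qaddA qaddC qadd0 qaddN.

Let a1 := approx_qrat hp (inZp1_int p (natr_int rat 1)).

Lemma qmulA : associative (@qmul p).
Proof.
move=> x y z; apply: (approx_uniq hp (approxM hp (ax x) (approxM hp (ax y) (ax z)))).
under [fun n => _]eq_fun do rewrite mulrA.
exact: (approxM hp (approxM hp (ax x) (ax y)) (ax z)).
Qed.

Lemma qmulC : commutative (@qmul p).
Proof.
move=> x y; apply: (approx_uniq hp (approxM hp (ax x) (ax y))).
under [fun n => _]eq_fun do rewrite mulrC.
exact: (approxM hp (ax y) (ax x)).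
Qed.

Lemma qmul1 : left_id (qrat p 1) (@qmul p).
Proof.
move=> x; apply: (approx_uniq hp (approxM hp a1 (ax x))).
by under [fun n => _]eq_fun do rewrite mul1r; exact: ax.
Qed.

Lemma qmulDl : left_distributive (@qmul p) (@qadd p).
Proof.
move=> x y z; apply: (approx_uniq hp (approxM hp (approxD hp (ax x) (ax y)) (ax z))).
under [fun n => _]eq_fun do rewrite mulrDl.
exact: (approxD hp (approxM hp (ax x) (ax z)) (approxM hp (ax y) (ax z))).
Qed.

Lemma qone_neq0 : qrat p 1 != qzero p :> K.
Proof.
apply/eqP => /(congr1 (fun x => qseq x 1)).
rewrite qrat_qseq //; last exact: inZp1_int.
move=> /= h; have := rmod_eqmp hp 1 1; rewrite h /eqmp expr1 sub0r mulNr mul1r rpredN.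
have p2 := prime_gt1 hp.
move=> hi; have := norm_intr_ge1 hi; rewrite invr_eq0 pnatr_eq0 -lt0n prime_gt0 // => /(_ isT).
rewrite normfV ger0_norm ?ler0n // invf_ge1 ?ltr0n ?prime_gt0 // lern1; lia.
Qed.

HB.instance Definition _ := GRing.Zmodule_isComNzRing.Build K qmulA qmulC qmul1 qmulDl qone_neq0.

Lemma approx_uniqK s (x y : K) : approx s x -> approx s y -> x = y.
Proof. exact: approx_uniq. Qed.

(* [x] lies in [p^n Z_p]. *)
Definition small (n : nat) (x : K) : Prop := qseq x n = 0.

Definition q_ (r : rat) : K := qrat p r.

Lemma smallP n (x : K) : small n x <-> eqmp p n (qseq x n) 0.
Proof.
split=> [->|h]; first exact: eqmp_refl.
by apply: (eqmp_qseq_eq hp (y := qzero p)).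
Qed.

Lemma qseqD (x y : K) n : eqmp p n (qseq (x + y) n) (qseq x n + qseq y n).
Proof.
have [N0 h0] := approxD hp (ax x) (ax y) n.
set N := maxn n N0.
apply: eqmp_trans (eqmp_sym (h0 N (leq_maxr _ _))) _.
by apply: eqmpD; apply: eqmp_qseq => //; exact: leq_maxl.
Qed.

Lemma qseqN (x : K) n : eqmp p n (qseq (- x) n) (- qseq x n).
Proof.
have [N0 h0] := approxN hp (ax x) n.
set N := maxn n N0.
apply: eqmp_trans (eqmp_sym (h0 N (leq_maxr _ _))) _.
by apply: eqmpN; apply: eqmp_qseq => //; exact: leq_maxl.
Qed.

Lemma small0 n : small n 0. Proof. by []. Qed.

Lemma smallD n (x y : K) : small n x -> small n y -> small n (x + y).
Proof.
by move=> hx hy; apply/smallP; have := qseqD x y n; rewrite hx hy addr0.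
Qed.

(** Translates between the balls that generate the sigma-algebra and closeness in the topological
    group. *)
Lemma small_subP n (x y : K) : small n (x - y) <-> qseq x n = qseq y n.
Proof.
split=> [/smallP h|e].
  apply: (eqmp_qseq_eq hp).
  have e : eqmp p n (qseq (x - y) n) (qseq x n - qseq y n).
    apply: eqmp_trans (qseqD _ _ _) _; apply: eqmpD (qseqN _ _); exact: eqmp_refl.
  have := eqmp_trans (eqmp_sym e) h; by rewrite /eqmp subr0.
apply/smallP.
apply: eqmp_trans (qseqD _ _ _) _.
have := eqmpD (eqmp_refl p n (qseq x n)) (qseqN y n).
by rewrite e subrr.
Qed.

Lemma small_le m n (x : K) : (n <= m)%N -> small m x -> small n x.
Proof. by move=> nm hx; apply/smallP; have := eqmp_qseq hp x nm; rewrite hx => /eqmp_sym. Qed.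

(** In terms of the norm, [|y| <= p^(dexp y)]; this is the continuity of multiplication by [y]. *)
Lemma smallMr n (x y : K) : small (n + dexp y) x -> small n (x * y).
Proof.
move=> hx.
have [N0 h0] := approxM hp (ax x) (ax y) n.
set N := maxn (n + dexp x + dexp y) N0.
apply/smallP; apply: eqmp_trans (eqmp_sym (h0 N (leq_maxr _ _))) _.
have le1 : (n + dexp y <= N)%N by rewrite /N; lia.
have := eqmp_qseq hp x le1; rewrite hx /eqmp !subr0 => k1.
have -> : qseq x N * qseq y N / p%:R ^+ n =
  (qseq x N / p%:R ^+ (n + dexp y)) * (qseq y N * p%:R ^+ dexp y) :> rat.
  by rewrite !exprD; field; rewrite !pX_neq0.
by apply: rpredM => //; exact: dexpP.
Qed.

Lemma dexp_small0 (x : K) : small 0 x -> dexp x = 0%N.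
Proof. by rewrite /dexp => ->; rewrite (_ : `|denq 0|%N = 1%N) ?logn1. Qed.

Lemma approx_mulX (x : K) s k : approx s x -> approx (fun n => s n * p%:R ^+ k) (x * q_ (p%:R ^+ k)).
Proof. by move=> h; apply: approxM => //; apply: approx_qrat => //; apply: inZp1_int; exact: pX_int. Qed.

Lemma qratD r s : inZp1 p r -> inZp1 p s -> q_ (r + s) = q_ r + q_ s.
Proof.
move=> hr hs; apply: (@approx_uniqK (fun=> r + s)); first exact: (approx_qrat hp (inZp1D hr hs)).
exact: (approxD hp (approx_qrat hp hr) (approx_qrat hp hs)).
Qed.

Lemma qratM r s : inZp1 p r -> inZp1 p s -> q_ (r * s) = q_ r * q_ s.
Proof.
move=> hr hs; apply: (@approx_uniqK (fun=> r * s)); first exact: (approx_qrat hp (inZp1M hr hs)).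
exact: (approxM hp (approx_qrat hp hr) (approx_qrat hp hs)).
Qed.

Lemma qrat0 : q_ 0 = 0.
Proof.
have h : inZp1 p 0 by apply: inZp1_int.
apply: (@approx_uniqK (fun=> 0)); first exact: approx_qrat.
exact: approx_qzero.
Qed.

Lemma qrat_nat n : q_ n%:R = n%:R.
Proof.
elim: n => [|n IH]; first exact: qrat0.
rewrite -addn1 !natrD qratD ?IH //; apply: inZp1_int; exact: natr_int.
Qed.

Lemma qrat_mulX r n : inZp1 p r -> q_ (r * p%:R ^+ n) = q_ r * p%:R ^+ n.
Proof. by move=> h; rewrite -natrX qratM ?qrat_nat ?natrX //; apply: inZp1_int; exact: pX_int. Qed.

Lemma inZp1_1 : inZp1 p 1.
Proof. exact: inZp1_int (natr_int rat 1). Qed.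

Lemma qrat_X n : q_ (p%:R ^+ n) = p%:R ^+ n.
Proof.
rewrite -[X in q_ X]mul1r (qrat_mulX n inZp1_1).
exact: (mul1r (p%:R ^+ n : K)).
Qed.

Lemma approx_mulpX (x : K) s k : approx s x -> approx (fun n => s n * p%:R ^+ k) (x * p%:R ^+ k).
Proof. by move=> h; rewrite -(qrat_X k); exact: approx_mulX. Qed.

Lemma small_approx n s (x : K) : approx s x -> 
  (exists N0, forall N, (N0 <= N)%N -> eqmp p n (s N) 0) -> small n x.
Proof.
move=> hx [N1 h1]; have [N0 h0] := hx n; apply/smallP.
apply: eqmp_trans (eqmp_sym (h0 (maxn N0 N1) (leq_maxl _ _))) (h1 _ (leq_maxr _ _)).
Qed.

Lemma small_mulX n k (x : K) : small (n + k) (x * p%:R ^+ k) <-> small n x.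
Proof.
have ap : approx (fun n => qseq x n * p%:R ^+ k) (x * p%:R ^+ k).
  by apply: approx_mulpX; exact: ax.
have e (r : rat) : eqmp p (n + k) (r * p%:R ^+ k) 0 <-> eqmp p n r 0.
  rewrite /eqmp !subr0 exprD.
  by have -> : r * p%:R ^+ k / (p%:R ^+ n * p%:R ^+ k) = r / p%:R ^+ n :> rat
     by field; rewrite !pX_neq0.
split=> h.
  have [N0 h0] := ap (n + k)%N; rewrite h in h0.
  apply: (small_approx (ax x)); exists N0 => N /h0; by rewrite e.
apply: (small_approx ap); exists n => N nN; rewrite e.
by have := eqmp_qseq hp x nN; rewrite h.
Qed.

Lemma smallX n : small n (p%:R ^+ n).
Proof.
rewrite -[_ ^+ _]mul1r -[X in small X]add0n small_mulX.
rewrite /small [qseq _ _](qrat_qseq hp 0 (inZp1_int p (natr_int rat 1))).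
by rewrite /rmod expr0 divr1 floor1 subrr.
Qed.

Lemma small_sub_qrat (x : K) n : small n (x - q_ (qseq x n)).
Proof.
apply/small_subP; rewrite qrat_qseq ?rmod_qseq //; exact: inZp1_qseq.
Qed.

Lemma qseq_eq0 (x : K) : (forall n, small n x) -> x = 0.
Proof. by move=> h; apply: Qp_ext => n; rewrite h. Qed.

Definition qunit (u : K) : Prop := small 0 u /\ ~ small 1 u.

(** Each integer [u_n] with [n > 0] is prime to [p], so Bezout inverts it modulo [p^n]. Inverses
    modulo [p^n] are unique, hence the choices are coherent and have a limit in [Z_p]. *)
Lemma qunit_inv (u : K) : qunit u -> exists v : K, u * v = 1 /\ small 0 v.
Proof.
move=> [u0 u1].
have ui n : qseq u n \is a Num.int.
  by have := eqmp_qseq hp u (leq0n n); rewrite u0 /eqmp expr0 divr1 subr0.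
have [a ha] : exists a : nat -> int, forall n, qseq u n = (a n)%:~R.
  have /choice[a ha] : forall n, exists m : int, qseq u n = m%:~R.
    by move=> n; apply/intrP.
  by exists a.
have cop n : coprimez (p%:Z ^+ n) (a n).
  case: n => [|n]; first by rewrite expr0 /coprimez gcd1z.
  apply: coprimezXl; rewrite coprimezE /= prime_coprime //; apply/negP => dv.
  apply: u1; apply/smallP; apply: eqmp_trans (eqmp_sym (eqmp_qseq hp u (ltn0Sn n))) _.
  rewrite /eqmp subr0 expr1 ha.
  have /dvdzP[c ->] : (p%:Z %| a n.+1)%Z by rewrite dvdzE.
  by rewrite rmorphM /= mulfK ?intr_int // pnatr_eq0 -lt0n prime_gt0.
have [c hc] : exists c : nat -> int, forall n, eqmp p n (qseq u n * (c n)%:~R) 1.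
  have /choice[c hc] : forall n, exists c : int, eqmp p n (qseq u n * c%:~R) 1.
    move=> n; have /coprimezP[[x y] /= xy] := cop n.
    exists y; rewrite ha /eqmp.
    have -> : (a n)%:~R * y%:~R - 1 = - (x%:~R * p%:R ^+ n) :> rat.
      have := congr1 (intmul 1 : int -> rat) xy; rewrite rmorphD !rmorphM rmorphXn /= => e.
      by rewrite -[X in _ - X]e -!pmulrn mulrC opprD addrCA subrr addr0.
    by rewrite mulNr mulfK ?pX_neq0 // rpredN intr_int.
  by exists c.
have cZ n : inZp1 p (c n)%:~R by apply: inZp1_int; exact: intr_int.
have cS n : eqmp p n (c n.+1)%:~R (c n)%:~R.
  have h1 := eqmp_le hp (leqnSn n) (hc n.+1).
  have h2 := hc n; have h3 := eqmp_qseq hp u (leqnSn n).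
  move: h1 h2 h3; rewrite /eqmp => h1' h2 h3.
  set A := (c n.+1)%:~R in h1' *; set B := (c n)%:~R in h2 *.
  (* Uniqueness of inverses made explicit: [A - B] is a combination of [u_(n+1) A - 1], [u_n B - 1]
     and [u_(n+1) - u_n], all divisible by [p^n]. *)
  have -> : (A - B) / p%:R ^+ n = B * ((qseq u n.+1 * A - 1) / p%:R ^+ n)
     - A * ((qseq u n * B - 1) / p%:R ^+ n) - A * B * ((qseq u n.+1 - qseq u n) / p%:R ^+ n) :> rat by ring.
  have iA : A \is a Num.int by exact: intr_int.
  have iB : B \is a Num.int by exact: intr_int.
  by apply: rpredB; [apply: rpredB|]; apply: rpredM => //; exact: rpredM.
pose v : K := qlim p (fun n => (c n)%:~R).
have va : approx (fun n => (c n)%:~R) v by apply: approx_qlim.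
exists v; split.
  apply: (@approx_uniqK (fun n => qseq u n * (c n)%:~R)); first exact: (approxM hp (ax u) va).
  move=> n; exists n => N nN.
  have := eqmp_le hp nN (hc N) => h.
  apply: eqmp_trans h _; rewrite [qseq _ _](qrat_qseq hp n (inZp1_int p (natr_int rat 1))).
  exact/eqmp_sym/rmod_eqmp.
apply: (small_approx va); exists 0%N => N ?.
by rewrite /eqmp subr0 divr1 intr_int.
Qed.

Lemma mul_pX_divX n : p%:R ^+ n * q_ (1 / p%:R ^+ n) = 1.
Proof.
by rewrite mulrC -qrat_mulX ?divfK ?pX_neq0 //; apply: inZp1_divX => //; exact: (natr_int _ 1).
Qed.

(** If [x p^(dexp x)] were still divisible by [p] in [Z_p], a smaller power of [p] would clear the
    denominator of [x_0]. *)
Lemma qnorm_neq0 (x : K) : qseq x 0 <> 0 ->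
  qunit (x * p%:R ^+ dexp x) /\ qnorm x = p%:R ^+ dexp x.
Proof.
move=> x0.
have dp : (0 < dexp x)%N.
  rewrite lt0n; apply/eqP => d0; apply: x0; apply/smallP.
  by have := dexpP hp x 0; rewrite d0 mulr1 /eqmp divr1 subr0.
have ap k : approx (fun n => qseq x n * p%:R ^+ k) (x * p%:R ^+ k).
  by apply: approx_mulpX; exact: ax.
have dE : (denq (qseq x 0))%:~R = p%:R ^+ dexp x :> rat.
  rewrite -natrX /dexp -denq_inZp1 //; last exact: inZp1_qseq.
  by rewrite -[in LHS](gez0_abs (denq_ge0 _)).
split; last first.
  by rewrite /qnorm; case: eqP => // _ /=.
split.
  apply: (small_approx (ap _)); exists 0%N => N ?.
  by rewrite /eqmp subr0 divr1 dexpP.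
case E: (dexp x) dp => [//|k] _ h.
have {h} : small (0 + 1) (x * p%:R ^+ k * p%:R ^+ 1) by rewrite -mulrA -exprSr.
rewrite small_mulX => h.
have hk : qseq x 0 * p%:R ^+ k \is a Num.int.
  have [N0 h0] := ap k 0%N.
  have := h0 N0 (leqnn _); rewrite h /eqmp expr0 divr1 subr0 => h1.
  have := eqmp_qseq hp x (leq0n N0); rewrite /eqmp expr0 divr1 => h2.
  have -> : qseq x 0 * p%:R ^+ k = qseq x N0 * p%:R ^+ k - (qseq x N0 - qseq x 0) * p%:R ^+ k by ring.
  by rewrite rpredB // rpredM ?pX_int.
have := hk => /intrP[m hm].
have : numq (qseq x 0) * p%:Z ^+ k = m * denq (qseq x 0).
  apply/eqP; rewrite -(eqr_int rat) !rmorphM /= -hm rmorphXn /=.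
  by rewrite mulrAC -{2}(divq_num_den (qseq x 0)) divfK // intr_eq0 denq_neq0.
move=> /(congr1 absz); rewrite !abszM abszX /= => e.
have : (`|denq (qseq x 0)| %| `|numq (qseq x 0)| * p ^ k)%N by rewrite e dvdn_mull.
rewrite Gauss_dvdr; last by rewrite coprime_sym coprime_num_den.
rewrite (denq_inZp1 hp (inZp1_qseq x 0)) -/(dexp x) E.
move=> /dvdn_leq; rewrite expn_gt0 prime_gt0 // => /(_ isT).
by rewrite leq_exp2l ?prime_gt1 // ltnn.
Qed.

Lemma qnorm_small0 (x : K) : qseq x 0 = 0 -> x <> 0 ->
  exists n, exists2 u : K, qunit u /\ x = u * p%:R ^+ n & qnorm x = p%:R ^- n.
Proof.
move=> x0 xn0.
have ex : exists n : nat, qseq x n.+1 != 0.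
  apply: contrapT => h; apply: xn0; apply: qseq_eq0 => -[//|n].
  by apply: contrapT => /eqP k; apply: h; exists n.
rewrite /qnorm x0 eqxx /=; case: pselect => // H.
(* By minimality of [n], [x_n = 0] while [x_(n+1) <> 0]: the shift by one in [qnorm] makes [n] the
   valuation of [x]. *)
case: ex_minnP => n hn hmin; exists n, (x * q_ (1 / p%:R ^+ n)) => //.
have e : x = x * q_ (1 / p%:R ^+ n) * p%:R ^+ n by rewrite -mulrA (mulrC (q_ _)) mul_pX_divX mulr1.
split=> //; split.
  rewrite -(small_mulX 0 n) -e add0n.
  case: n hmin {hn e} => [//|n] hmin.
  by apply: contrapT => /eqP /hmin; rewrite ltnn.
by rewrite -(small_mulX 1 n) -e add1n => /eqP; rewrite (negbTE hn).
Qed.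

(** The two natural exponents stand for the integer valuation [j - i]. The equation avoids division
    because it serves to construct the inverse. *)
Lemma qunit_decomp (x : K) : x <> 0 -> exists i j, exists2 u : K,
  qunit u /\ x * p%:R ^+ i = u * p%:R ^+ j & qnorm x = p%:R ^+ i / p%:R ^+ j.
Proof.
move=> xn0; have [x0|/qnorm_neq0[h1 h2]] := pselect (qseq x 0 = 0).
  have [n [u [hu e] nx]] := qnorm_small0 x0 xn0.
  by exists 0%N, n, u; rewrite ?expr0 ?mulr1 ?mul1r.
by exists (dexp x), 0%N, (x * p%:R ^+ dexp x); rewrite ?expr0 ?mulr1 ?divr1.
Qed.

Lemma qinv_ex (x : K) : exists y : K, x <> 0 -> y * x = 1.
Proof.
have [->|xn0] := pselect (x = 0); first by exists 0.
have [i [j [u [hu e] ?]]] := qunit_decomp xn0.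
have [v [uv _]] := qunit_inv hu.
exists (v * p%:R ^+ i * q_ (1 / p%:R ^+ j)) => _.
have -> : v * p%:R ^+ i * q_ (1 / p%:R ^+ j) * x = v * (x * p%:R ^+ i) * q_ (1 / p%:R ^+ j) by ring.
by rewrite e mulrA (mulrC v) uv mul1r mul_pX_divX.
Qed.

Definition qinv (x : K) : K := if x == 0 then 0 else sval (cid (qinv_ex x)).

Lemma qmulVx (x : K) : x != 0 -> qinv x * x = 1.
Proof. by move=> h; rewrite /qinv (negbTE h); case: cid => y /= ->; [|exact/eqP]. Qed.

Lemma qinv0 : qinv 0 = 0. Proof. by rewrite /qinv eqxx. Qed.

HB.instance Definition _ := GRing.ComNzRing_isField.Build K qmulVx qinv0.

Lemma pnat_neq0 : (p%:R : K) != 0.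
Proof.
apply/eqP => h; have := mul_pX_divX 1; rewrite expr1 h mul0r => /eqP.
by rewrite eq_sym oner_eq0.
Qed.

Lemma qrat_divX n : q_ (1 / p%:R ^+ n) = (p%:R ^+ n)^-1.
Proof.
have h : (p%:R ^+ n : K) != 0 by rewrite expf_neq0 // pnat_neq0.
by apply: (mulfI h); rewrite mul_pX_divX divff.
Qed.

(** Since [0 < n < p^n], the integer [n] is not divisible by [p^n]. The case [n = 2] permits halving
    in [cflike_quadratic], also for [p = 2]. *)
Lemma natr_neq0 n : (0 < n)%N -> (n%:R : K) != 0.
Proof.
move=> n0; rewrite -qrat_nat; apply/eqP => h.
have hz : inZp1 p n%:R by apply: inZp1_int; exact: natr_int.
have := congr1 (fun x => qseq x n) h.
rewrite qrat_qseq //= => e; have := rmod_eqmp hp n (n%:R); rewrite e.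
rewrite /eqmp sub0r mulNr rpredN => hi; have := norm_intr_ge1 hi.
have h0 : (n%:R : rat) / p%:R ^+ n != 0 by rewrite mulf_neq0 ?invr_neq0 ?pX_neq0 // pnatr_eq0 -lt0n.
rewrite h0 => /(_ isT); rewrite ger0_norm; last by rewrite divr_ge0 ?exprn_ge0 ?ler0n.
rewrite ler_pdivlMr ?exprn_gt0 ?ltr0n ?prime_gt0 // mul1r -natrX ler_nat.
by have := ltn_expl n (prime_gt1 hp); lia.
Qed.

Lemma qunitMV (u v : K) : qunit u -> qunit v -> small 0 (u / v).
Proof.
move=> [u0 _] hv; have [w [vw w0]] := qunit_inv hv.
have v0 : v != 0.
  by apply/eqP => h; move: hv; rewrite h => -[_]; apply.
have -> : v^-1 = w by apply: (mulfI v0); rewrite divff.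
by apply: smallMr; rewrite (dexp_small0 w0).
Qed.

(** Norms of nonzero elements are integer powers of [p], so of two different ones the larger is at
    least [p] times the smaller. *)
Lemma qnorm_neq (a b : K) : a <> 0 -> b <> 0 -> qnorm a <> qnorm b ->
  small 1 (a / b) \/ small 1 (b / a).
Proof.
move=> a0 b0.
have [i [j [u [hu eu] ->]]] := qunit_decomp a0.
have [k [l [v [hv ev] ->]]] := qunit_decomp b0 => ne.
have pn n : (p%:R ^+ n : K) != 0 by rewrite expf_neq0 // pnat_neq0.
have n0 (w : K) : qunit w -> w != 0 by move=> h; apply/eqP => e; move: h; rewrite e => -[_]; apply.
have main (x y : nat) (s : K) : (x < y)%N -> small 0 s -> small 1 (s * p%:R ^+ y / p%:R ^+ x).
  move=> xy s0; have -> : s * p%:R ^+ y / p%:R ^+ x = s * p%:R ^+ (y - x).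
    by rewrite -{1}(subnKC (ltnW xy)) exprD; field; rewrite pn.
  by apply: (@small_le (y - x)); [lia|rewrite -[X in small X]add0n small_mulX].
have ea : a = u * p%:R ^+ j / p%:R ^+ i by rewrite -eu mulfK.
have eb : b = v * p%:R ^+ l / p%:R ^+ k by rewrite -ev mulfK.
have [lt|le] := ltnP (i + l) (j + k).
  left; have -> : a / b = (u / v) * p%:R ^+ (j + k) / p%:R ^+ (i + l).
    by rewrite ea eb !exprD; field; rewrite !pn n0.
  by apply: main => //; exact: qunitMV.
have [lt|le2] := ltnP (j + k) (i + l).
  right; have -> : b / a = (v / u) * p%:R ^+ (i + l) / p%:R ^+ (j + k).
    by rewrite ea eb !exprD; field; rewrite !pn n0.
  by apply: main => //; exact: qunitMV.
case: ne; apply/eqP; rewrite eqr_div ?pX_neq0 // -!exprD.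
by apply/eqP; congr (_ ^+ _); lia.
Qed.

End PadicRing.

(** * Rational points of the circle and the standard character *)

Section ComplexSequences.
Variable R : realType.
Implicit Types (u v : nat -> R[i]) (z l : R[i]).
Local Notation cRe := (@complex.Re R).
Local Notation cIm := (@complex.Im R).

(** Componentwise, so that limits and dominated convergence for real functions apply directly. *)
Definition ccvg u l : Prop :=
  ((fun n => cRe (u n)) @ \oo --> cRe l) /\ ((fun n => cIm (u n)) @ \oo --> cIm l).

Lemma cReM z w : cRe (z * w) = cRe z * cRe w - cIm z * cIm w.
Proof. by case: z w => a b [c d]. Qed.

Lemma cImM z w : cIm (z * w) = cRe z * cIm w + cIm z * cRe w.
Proof. by case: z w => a b [c d]. Qed.

Lemma cReD z w : cRe (z + w) = cRe z + cRe w.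
Proof. by case: z w => a b [c d]. Qed.

Lemma cImD z w : cIm (z + w) = cIm z + cIm w.
Proof. by case: z w => a b [c d]. Qed.

Lemma ccvg_cst l : ccvg (fun _ => l) l.
Proof. by split; exact: cvg_cst. Qed.

Lemma ccvgM u v l l' : ccvg u l -> ccvg v l' -> ccvg (fun n => u n * v n) (l * l').
Proof.
move=> [u1 u2] [v1 v2]; split.
  rewrite cReM; under eq_fun do rewrite cReM.
  by apply: cvgB; apply: cvgM.
rewrite cImM; under eq_fun do rewrite cImM.
by apply: cvgD; apply: cvgM.
Qed.

Lemma ccvg_uniq u l l' : ccvg u l -> ccvg u l' -> l = l'.
Proof.
move=> [u1 u2] [v1 v2]; apply/eqP; rewrite eq_complex; apply/andP; split; apply/eqP.
  exact: (cvg_unique _ u1 v1).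
exact: (cvg_unique _ u2 v2).
Qed.

Lemma ccvg_eventually u l : (exists N, forall n, (N <= n)%N -> u n = l) -> ccvg u l.
Proof.
move=> [N hN]; split; apply: cvg_near_cst; exists N => // n /= /hN ->; by [].
Qed.

Lemma ccvgV u l : l != 0 -> ccvg u l -> ccvg (fun n => (u n)^-1) l^-1.
Proof.
have cReV z : cRe z^-1 = cRe z / (cRe z ^+ 2 + cIm z ^+ 2) by case: z.
have cImV z : cIm z^-1 = - (cIm z / (cRe z ^+ 2 + cIm z ^+ 2)) by case: z.
move=> l0 [u1 u2].
have n0 : cRe l ^+ 2 + cIm l ^+ 2 != 0.
  move: l0; apply: contraNneq => /eqP.
  by rewrite paddr_eq0 ?sqr_ge0 // !sqrf_eq0 eq_complex /=.
have nc : (fun n => cRe (u n) ^+ 2 + cIm (u n) ^+ 2) @ \oo --> cRe l ^+ 2 + cIm l ^+ 2.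
  by rewrite !expr2; under eq_fun do rewrite !expr2; apply: cvgD; apply: cvgM.
split.
  rewrite cReV; under eq_fun do rewrite cReV.
  by apply: cvgM => //; apply: cvgV.
rewrite cImV; under eq_fun do rewrite cImV.
by apply: cvgN; apply: cvgM => //; apply: cvgV.
Qed.

Lemma ccvg_Re_ge u l (a : R) : ccvg u l -> (forall n, a <= cRe (u n)) -> a <= cRe l.
Proof.
move=> [u1 _] h; rewrite -(cvg_lim _ u1) //; apply: limr_ge; first by apply/cvg_ex; exists (cRe l).
exact: nearW.
Qed.

Lemma ccvg_Re_le u l (a : R) : ccvg u l -> (forall n, cRe (u n) <= a) -> cRe l <= a.
Proof.
move=> [u1 _] h; rewrite -(cvg_lim _ u1) //; apply: limr_le; first by apply/cvg_ex; exists (cRe l).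
exact: nearW.
Qed.

End ComplexSequences.

Section RationalExponential.
Variable R : realType.
Local Notation cRe := (@complex.Re R).
Local Notation cIm := (@complex.Im R).

Definition e2pi (r : rat) : R[i] :=
  (cos (2 * pi * ratr r) +i* sin (2 * pi * ratr r))%C.

Lemma e2piD r s : e2pi (r + s) = e2pi r * e2pi s.
Proof.
rewrite /e2pi rmorphD mulrDr cosD sinD.
by apply/eqP; rewrite eq_complex /= eqxx /= addrC [X in X + _]mulrC [X in _ + X]mulrC.
Qed.

Lemma e2pi0 : e2pi 0 = 1.
Proof. by rewrite /e2pi rmorph0 mulr0 cos0 sin0. Qed.

Lemma e2pi1 : e2pi 1 = 1.
Proof. by rewrite /e2pi rmorph1 mulr1 mulr_natl cos2pi sin2pi. Qed.

Lemma e2piN r : e2pi (- r) = (e2pi r)^*%C.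
Proof. by rewrite /e2pi rmorphN mulrN cosN sinN. Qed.

Lemma e2piJ r : e2pi r * (e2pi r)^*%C = 1.
Proof. by rewrite -e2piN -e2piD subrr e2pi0. Qed.

Lemma e2pi_norm r : `|e2pi r| = 1.
Proof.
by apply/eqP; rewrite -(@eqrXn2 _ 2) // sqr_normc e2piJ expr1n.
Qed.

Lemma e2pi_neq0 r : e2pi r != 0.
Proof. by rewrite -normr_gt0 e2pi_norm. Qed.

Lemma e2piMn r n : e2pi (r *+ n) = e2pi r ^+ n.
Proof. by elim: n => [|n IH]; rewrite ?e2pi0 // mulrS e2piD IH exprS. Qed.

Lemma e2pi_int r : r \is a Num.int -> e2pi r = 1.
Proof.
have nat n : e2pi n%:R = 1 by rewrite e2piMn e2pi1 expr1n.
move=> /intrP[[n|n] ->]; first by rewrite -pmulrn nat.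
by rewrite NegzE mulrNz -pmulrn e2piN nat conjc1.
Qed.

(** For the fractional part [f] of [r], [cos (2 pi f) = 1] forces [sin (pi f) = 0] by the double
    angle formula, whereas [sin] is positive at [pi f] when [0 < f < 1]. *)
Lemma e2pi_eq1 r : e2pi r = 1 -> r \is a Num.int.
Proof.
move=> h; set f := r - (Num.floor r)%:~R.
have /andP[f0 f1] : 0 <= f < 1.
  have /andP[h1 h2] := floor_itv r.
  by rewrite /f subr_ge0 h1 ltrBlDl addrC; rewrite rmorphD /= in h2; rewrite addrC.
have hf : e2pi f = 1 by rewrite e2piD h mul1r e2piN e2pi_int ?conjc1 ?intr_int.
suff fe : f = 0 by move/eqP: fe; rewrite subr_eq0 => /eqP ->; exact: intr_int.
apply/eqP; rewrite eq_le f0 andbT leNgt; apply/negP => f00.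
have := congr1 cRe hf; rewrite /= -mulrA mulr_natl cos_mulr2n.
move=> c1; have c2 : cos (pi * ratr f) ^+ 2 = 1 :> R by rewrite mulr2n in c1; lra.
have s0 : 0 < sin (pi * ratr f) :> R.
  apply: sin_gt0_pi; rewrite mulr_gt0 ?pi_gt0 ?ltr0q //=.
  rewrite gtr_pMr ?pi_gt0 //.
  by have : ratr f < ratr 1 :> R by [rewrite ltr_rat]; rewrite rmorph1.
have := cos2Dsin2 (pi * ratr f : R); rewrite c2 => h2.
have : sin (pi * ratr f) ^+ 2 = 0 :> R by lra.
by apply/eqP; rewrite sqrf_eq0 gt_eqF.
Qed.

(** By [e2pi_eq1] the number [e2pi (1 / M)] is a primitive [M]-th root of unity, so its powers
    exhaust the roots of unity of order dividing [M]. *)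
Lemma e2pi_root (M : nat) (z : R[i]) : (0 < M)%N -> z ^+ M = 1 ->
  exists j : nat, z = e2pi (j%:R / M%:R).
Proof.
move=> M0 zM; have pr : M.-primitive_root (e2pi (1 / M%:R)).
  apply/andP; split => //; apply/forallP => i; rewrite unity_rootE -e2piMn -[_ *+ i.+1]mulr_natr.
  have Mn : (M%:R : rat) != 0 by rewrite pnatr_eq0 -lt0n.
  apply/eqP; have [e|ne] := eqVneq (i.+1) M.
    by rewrite e mul1r mulVf // e2pi1 eqxx.
  apply/negbTE/eqP => /e2pi_eq1 hi.
  have h0 : 1 / M%:R * i.+1%:R != 0 :> rat by rewrite !mulf_neq0 ?oner_eq0 ?invr_eq0 // pnatr_eq0.
  have := norm_intr_ge1 hi h0; rewrite ger0_norm; last by rewrite !mulr_ge0 ?invr_ge0 ?ler0n.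
  rewrite mul1r mulrC ler_pdivlMr ?ltr0n // mul1r ler_nat => le.
  by move: ne; rewrite eqn_leq le (ltn_ord i).
have [i ->] := prim_rootP pr zM; exists i.
by rewrite -e2piMn -[_ *+ i]mulr_natl mulrA mulr1.
Qed.

Variables (p : nat) (hp : prime p).
Local Notation K := (Qpf hp).

(** The standard character [exp (2 pi i {x}_p)]. The pairing [(x, y)] is [Psi (x * y)], with real
    and imaginary parts [qchar_re] and [qchar_im]. *)
Definition Psi (x : K) : R[i] := e2pi (qseq x 0).

Lemma Psi_small (x : K) : small 0 x -> Psi x = 1.
Proof. by rewrite /Psi => ->; exact: e2pi0. Qed.

Lemma e2pi_eqmp r s : eqmp p 0 r s -> e2pi r = e2pi s.
Proof.
rewrite /eqmp expr0 divr1 => h; rewrite -(subrK s r) e2piD e2pi_int // mul1r //.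
Qed.

Lemma PsiD (x y : K) : Psi (x + y) = Psi x * Psi y.
Proof. by rewrite /Psi -e2piD; apply: e2pi_eqmp; exact: qseqD. Qed.

Lemma Psi0 : Psi 0 = 1. Proof. exact: Psi_small (small0 hp 0). Qed.

Lemma PsiN (x : K) : Psi (- x) = (Psi x)^*%C.
Proof. by rewrite /Psi -e2piN; apply: e2pi_eqmp; exact: qseqN. Qed.

Lemma PsiJ (x : K) : Psi x * (Psi x)^*%C = 1.
Proof. exact: e2piJ. Qed.

Lemma Psi_norm (x : K) : `|Psi x| = 1.
Proof. exact: e2pi_norm. Qed.

Lemma Psi_neq0 (x : K) : Psi x != 0.
Proof. exact: e2pi_neq0. Qed.

Lemma PsiMn (x : K) n : Psi (x *+ n) = Psi x ^+ n.
Proof. by elim: n => [|n IH]; rewrite ?Psi0 // mulrS PsiD IH exprS. Qed.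

(** Modulo [Z_p], [x / p^n] depends only on [x] modulo [p^n], so any representative of index at
    least [n] computes the value. *)
Lemma Psi_divX (x : K) n N : (n <= N)%N ->
  Psi (x / p%:R ^+ n) = e2pi (qseq x N / p%:R ^+ n).
Proof.
move=> nN; apply: e2pi_eqmp.
have hz : inZp1 p (1 / p%:R ^+ n) by apply: (inZp1_divX hp); exact: (natr_int _ 1).
have [N0 h0] := approxM hp (approx_qseq hp x) (approx_qrat hp hz) 0.
rewrite -qrat_divX; apply: eqmp_trans (eqmp_sym (h0 (maxn N N0) (leq_maxr _ _))) _.
have := eqmp_qseq hp x (leq_trans nN (leq_maxl N N0)); have := eqmp_qseq hp x nN.
rewrite /eqmp expr0 !divr1 => h1 h2.
set a := qseq x (maxn N N0) in h2 *.
have -> : a * (1 / p%:R ^+ n) - qseq x N / p%:R ^+ n =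
  (a - qseq x n) / p%:R ^+ n - (qseq x N - qseq x n) / p%:R ^+ n by ring.
exact: rpredB.
Qed.

End RationalExponential.

(** * Characters of Q_p *)

Section CharacteristicLike.
Variables (R : realType) (p : nat) (hp : prime p).
Local Notation K := (Qpf hp).
Local Notation cRe := (@complex.Re R).
Local Notation cIm := (@complex.Im R).
Implicit Types (f g : K -> R[i]) (x y z : K).

Definition qcvg (u : nat -> K) x : Prop :=
  forall m, exists N, forall n, (N <= n)%N -> small m (u n - x).

(** The properties of a nowhere-vanishing characteristic function that survive products, inverses
    and dilations; positive definiteness is lost under inverses. Continuity is sequential, which is
    how dominated convergence delivers it. *)
Record cflike f : Prop := CFLike {
  cflike0 : f 0 = 1;
  cflikeN : forall x, f (- x) = (f x)^*%C;
  cflike_neq0 : forall x, f x != 0;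
  cflike_cvg : forall u x, qcvg u x -> ccvg (fun n => f (u n)) (f x) }.

Lemma qcvgM a u x : qcvg u x -> qcvg (fun n => a * u n) (a * x).
Proof.
move=> h m; have [N hN] := h (m + dexp a)%N; exists N => n /hN k.
by rewrite -mulrBr mulrC; exact: smallMr.
Qed.

Lemma qcvg_shift x y : qcvg (fun n => x + p%:R ^+ n * y) x.
Proof.
move=> m; exists (m + dexp y)%N => n le; rewrite addrAC subrr add0r.
by apply: smallMr; apply: small_le le _; exact: smallX.
Qed.

Lemma cflikeM f g : cflike f -> cflike g -> cflike (fun x => f x * g x).
Proof.
move=> [f0 fN fn fc] [g0 gN gn gc]; split.
- by rewrite f0 g0 mulr1.
- by move=> x; rewrite fN gN rmorphM.
- by move=> x; rewrite mulf_neq0.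
- by move=> u x ux; apply: ccvgM; [exact: fc|exact: gc].
Qed.

Lemma cflikeV f : cflike f -> cflike (fun x => (f x)^-1).
Proof.
move=> [f0 fN fn fc]; split.
- by rewrite f0 invr1.
- by move=> x; rewrite fN conjc_inv.
- by move=> x; rewrite invr_eq0.
- by move=> u x ux; apply: ccvgV => //; exact: fc.
Qed.

Lemma cflike_scale f a : cflike f -> cflike (fun x => f (a * x)).
Proof.
move=> [f0 fN fn fc]; split.
- by rewrite mulr0.
- by move=> x; rewrite mulrN.
- by move=> x.
- by move=> u x ux; apply: fc; exact: qcvgM.
Qed.

Lemma cflike_Psi a : cflike (fun x => Psi R (a * x)).
Proof.
apply: cflike_scale; split.
- exact: Psi0.
- exact: PsiN.
- exact: Psi_neq0.
- move=> u x ux; apply: ccvg_eventually; have [N hN] := ux 0%N; exists N => n /hN h.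
  by rewrite -(subrK x (u n)) PsiD Psi_small // mul1r.
Qed.

(* [b x y = f (x + y) / (f x f y)] is bimultiplicative, and [b x x = |f x|^2] by
   the symmetry of [f]; halving makes every value of [b] positive, and
   [b x (p^k y) = b x y ^ p^k] tends to [1], so [b = 1]. *)
Lemma cflike_quadratic f : cflike f ->
  (forall x y z, f (x + y + z) * f x * f y * f z = f (x + y) * f (x + z) * f (y + z)) ->
  {morph f : x y / x + y >-> x * y}.
Proof.
move=> [f0 fN fn fc] quad.
pose b x y := f (x + y) / (f x * f y).
have bDl x y z : b (x + y) z = b x z * b y z.
  have e : f (x + y + z) = f (x + y) * f (x + z) * f (y + z) / (f x * f y * f z).
    by rewrite -quad; field; rewrite !fn.
  by rewrite /b e; field; rewrite !fn.
have bC x y : b x y = b y x by rewrite /b addrC (mulrC (f x)).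
have bx0 x : b x 0 = 1 by rewrite /b addr0 f0 mulr1 divff.
have bDr x y z : b z (x + y) = b z x * b z y by rewrite bC bDl !(bC z).
have bxx x : b x x = f x * (f x)^*%C.
  have : b x x * b x (- x) = 1 by rewrite -bDr subrr bx0.
  rewrite {2}/b subrr f0 fN mul1r => h.
  have n0 : f x * (f x)^*%C != 0 by rewrite mulf_neq0 // -fN.
  by rewrite -[LHS](mulfK n0) mulrAC h mul1r.
have bxx0 x : 0 < b x x by rewrite bxx -sqr_normc exprn_gt0 // normr_gt0.
(* In [R[i]] the relation [0 < z] says that [z] is real and positive. The square is isolated from [b
   (x + y) (x + y) = b x x * b x y ^+ 2 * b y y], whose diagonal terms are positive. *)
have b2 x y : 0 < b x y ^+ 2.
  have -> : b x y ^+ 2 = b (x + y) (x + y) / (b x x * b y y).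
    rewrite bDl !bDr (bC y x); field.
    by rewrite !lt0r_neq0.
  by rewrite divr_gt0 // mulr_gt0.
have n2 : (2%:R : K) != 0 by exact: natr_neq0.
have bpos x y : 0 < b x y.
  have -> : x = x / 2%:R + x / 2%:R by rewrite -mulrDl -mulr2n -[x *+ 2]mulr_natr mulfK.
  by rewrite bDl -expr2.
have bMn x y n : b x (y *+ n) = b x y ^+ n.
  by elim: n => [|n IH]; rewrite ?bx0 // mulrS bDr IH exprS.
have b1 x y : b x y = 1.
  have lim : ccvg (fun k => b x y ^+ (p ^ k)) 1.
    have -> : (fun k => b x y ^+ (p ^ k)) = fun k => f (x + p%:R ^+ k * y) * (f x * f (0 + p%:R ^+ k * y))^-1.
      by apply/funext => k; rewrite -bMn add0r -natrX mulr_natl.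
    have -> : 1 = f x * (f x * f 0)^-1 by rewrite f0 mulr1 divff.
    apply: ccvgM; first by apply: fc; exact: qcvg_shift.
    apply: ccvgV; first by rewrite mulf_neq0.
    apply: ccvgM; [exact: ccvg_cst|apply: fc; exact: qcvg_shift].
  have p0 k : (0 < p ^ k)%N by rewrite expn_gt0 prime_gt0.
  have := bpos x y; move: (b x y) lim => c lim c0.
  (* If [c < 1] then [c^(p^k) <= c < 1] for all [k], and if [c > 1] then [c^(p^k) >= c > 1]; neither
     is compatible with the limit [1]. *)
  have [c1|c1|//] := real_ltgtP (gtr0_real c0) (gtr0_real ltr01).
    have : cRe 1 <= cRe c.
      apply: ccvg_Re_le lim _ => k.
      have : c ^+ (p ^ k) <= c by apply: ler_iXnr => //; [exact: ltW|exact: ltW].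
      by rewrite lecE => /andP[].
    by move: c1; rewrite ltcE => /andP[_]; rewrite ltNge => /negbTE ->.
  have : cRe c <= cRe 1.
    apply: ccvg_Re_ge lim _ => k.
    have : c <= c ^+ (p ^ k) by apply: ler_eXnr => //; exact: ltW.
    by rewrite lecE => /andP[].
  by move: c1; rewrite ltcE => /andP[_]; rewrite ltNge => /negbTE ->.
move=> x y; have := b1 x y; rewrite /b => /eqP.
by rewrite eq_sym -(inj_eq (mulIf (mulf_neq0 (fn x) (fn y)))) mul1r divfK ?mulf_neq0 // eq_sym => /eqP.
Qed.

(** * Self-duality: continuous characters of [Q_p] come from the standard one *)

Section Characters.
Variable f : K -> R[i].
Hypotheses (cf : cflike f) (fD : {morph f : x y / x + y >-> x * y}).

Lemma charMn x n : f (x *+ n) = f x ^+ n.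
Proof. by elim: n => [|n IH]; rewrite ?(cflike0 cf) // mulrS fD IH exprS. Qed.

Lemma charJ x : f x * (f x)^*%C = 1.
Proof. by rewrite -(cflikeN cf) -fD subrr (cflike0 cf). Qed.

(* No small subgroups: while [Re z > 0], squaring a unit complex number [z] at
   least doubles [1 - Re z]. *)
Lemma char_trivial_nbhs : exists m, forall x, small m x -> f x = 1.
Proof.
apply: contrapT => h.
have neg m : exists x, small m x /\ cRe (f x) <= 0.
  apply: contrapT => hm; apply: h; exists m => x xm.
  have pos n : 0 < cRe (f x ^+ (2 ^ n)).
    rewrite ltNge; apply/negP => le; apply: hm; exists (x *+ 2 ^ n); split; last by rewrite charMn.
    by elim: (2 ^ n)%N => [|k IH]; rewrite ?mulrS //; exact: smallD.
  have unit1 y : cRe (f y) ^+ 2 + cIm (f y) ^+ 2 = 1.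
    have := congr1 cRe (charJ y); case: (f y) => a c /=; rewrite mulrN opprK !expr2; exact.
  (* On the unit circle [1 - Re (z^2) = 2 (1 - Re z) (1 + Re z)]. *)
  have grow n : 2 ^+ n * (1 - cRe (f x)) <= 1 - cRe (f x ^+ (2 ^ n)).
    elim: n => [|n IH]; first by rewrite expr0 mul1r expn0 expr1.
    rewrite exprS expnSr exprM [X in _ <= _ - cRe X]expr2 cReM.
    have := pos n; move: IH; have := unit1 (x *+ 2 ^ n); rewrite charMn.
    move: (cRe (f x ^+ (2 ^ n))) (cIm (f x ^+ (2 ^ n))) => a c e1 IH a0.
    rewrite -mulrA; move: (2 ^+ n * _) IH => w IH.
    rewrite !expr2 in e1; have a1 : a <= 1 by nra.
    nra.
  have Re1 : cRe (f x) = 1.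
    apply/eqP; rewrite eq_le; apply/andP; split; first by have := unit1 x; nra.
    rewrite leNgt; apply/negP => lt.
    have d0 : 0 < 1 - cRe (f x) by rewrite subr_gt0.
    have := archi_boundP (ltW (divr_gt0 ltr01 d0)); set n := Num.bound _ => bn.
    have := grow n; have := pos n; move: bn; rewrite ltr_pdivrMr // => bn p1 g1.
    have : (n%:R : R) <= 2 ^+ n by rewrite -natrX ler_nat ltnW // ltn_expl.
    rewrite -(ler_pM2r d0); lra.
  have /eqP : cIm (f x) ^+ 2 = 0 by have := unit1 x; rewrite Re1 expr1n; lra.
  rewrite sqrf_eq0 => /eqP Im0.
  by apply/eqP; rewrite eq_complex Re1 Im0 /= !eqxx.
have [u hu] := choice neg.
(* The points [u n] lie in [p^n Z_p] and tend to [0], so [f (u n)] tends to [1], which contradicts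
   real parts that are at most [0]. *)
have : ccvg (fun n => f (u n)) 1.
  rewrite -(cflike0 cf); apply: (cflike_cvg cf) => m; exists m => n mn.
  by rewrite subr0; apply: small_le mn _; case: (hu n).
move=> /ccvg_Re_le /(_ (fun n => proj2 (hu n))) /=.
by rewrite ler10.
Qed.

Lemma rmod_ge0 r n : 0 <= rmod r (p%:R ^+ n).
Proof.
have p0 : 0 < p%:R ^+ n :> rat by rewrite exprn_gt0 // ltr0n prime_gt0.
rewrite /rmod subr_ge0 -ler_pdivlMr //.
by have /andP[] := floor_itv (r / p%:R ^+ n).
Qed.

Lemma qrat_decomp r : inZp1 p r -> 0 <= r -> exists s j, q_ hp r = (p%:R ^+ s)^-1 *+ j.
Proof.
move=> [s hs] r0; exists s.
have : r * p%:R ^+ s \is a Num.nat by rewrite natrEint hs mulr_ge0 // exprn_ge0 ?ler0n.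
move=> /natrP[j ej]; exists j.
have ps0 : (p%:R ^+ s : K) != 0 by rewrite expf_neq0 // pnat_neq0.
have e : q_ hp r * p%:R ^+ s = j%:R by rewrite -qrat_mulX ?ej ?qrat_nat //; exists s.
by rewrite -[LHS](mulfK ps0) e mulr_natl.
Qed.

(** As [f] is trivial on [p^m0 Z_p], the value [f (p^-n)] is a root of unity
    [e2pi (j_n / p^(m0 + n))]. The relation [f (p^-(n+1))^p = f (p^-n)] says that the
    [c_n = j_n / p^m0] are coherent; their limit is [a]. Then [f] and [Psi (a y)] agree at all
    [p^-n], hence on the nonnegative elements of [Z[1/p]], which are dense. *)
Lemma char_Psi : exists a : K, forall y, f y = Psi R (a * y).
Proof.
have [m0 hm0] := char_trivial_nbhs.
have pn0 n : (p%:R ^+ n : K) != 0 by rewrite expf_neq0 // pnat_neq0.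
have pr0 n : (p%:R ^+ n : rat) != 0 by exact: pX_neq0.
have pr1 : (p%:R : rat) != 0 by have := pr0 1%N; rewrite expr1.
have [j hj] : exists j : nat -> nat, forall n,
    f (p%:R ^+ n)^-1 = e2pi R ((j n)%:R / p%:R ^+ (m0 + n)).
  have /choice[j hj] : forall n, exists j : nat, f (p%:R ^+ n)^-1 = e2pi R (j%:R / p%:R ^+ (m0 + n)).
    move=> n; have P0 : (0 < p ^ (m0 + n))%N by rewrite expn_gt0 prime_gt0.
    have : f (p%:R ^+ n)^-1 ^+ (p ^ (m0 + n)) = 1.
      rewrite -charMn hm0 // -[_ *+ (p ^ _)]mulr_natl natrX exprD mulfK //; exact: smallX.
    by move=> /(e2pi_root P0)[k ->]; exists k; rewrite natrX.
  by exists j.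
pose c n : rat := (j n)%:R / p%:R ^+ m0.
have cZ n : inZp1 p (c n) by apply: (inZp1_divX hp); exact: natr_int.
have cS n : eqmp p n (c n.+1) (c n).
  apply: (@e2pi_eq1 R).
  have -> : (c n.+1 - c n) / p%:R ^+ n =
     ((j n.+1)%:R / p%:R ^+ (m0 + n.+1)) *+ p - (j n)%:R / p%:R ^+ (m0 + n).
    rewrite /c addnS exprS !exprD -[(_ / _) *+ p]mulr_natr; field.
    by rewrite !(pr0, pr1).
  rewrite e2piD e2piN e2piMn -!hj -charMn.
  have -> : (p%:R ^+ n.+1)^-1 *+ p = (p%:R ^+ n)^-1 :> K.
    by rewrite -[_^-1 *+ p]mulr_natl exprS invfM mulrA divff ?mul1r // pnat_neq0.
  exact: charJ.
pose a : K := qlim p c.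
have fa n : f (p%:R ^+ n)^-1 = Psi R (a * (p%:R ^+ n)^-1).
  rewrite (Psi_divX R a (leqnn n)) hj [qseq a n](qlim_qseq hp n cZ cS).
  apply: (@e2pi_eqmp _ p); rewrite /eqmp expr0 divr1.
  have -> : (j n)%:R / p%:R ^+ (m0 + n) = c n / p%:R ^+ n.
    by rewrite /c exprD invfM mulrA.
  have := eqmp_sym (rmod_eqmp hp n (c n)); by rewrite /eqmp mulrBl.
(* Both [f] and [Psi (a y)] are trivial on [p^M Z_p], so [y] may be replaced by its representative
   [y_M], which is nonnegative. *)
exists a => y; pose M := maxn m0 (dexp a).
rewrite -(subrK (q_ hp (qseq y M)) y) mulrDr PsiD fD.
have sm := small_sub_qrat y M.
rewrite hm0; last by apply: small_le sm; exact: leq_maxl.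
rewrite Psi_small ?mul1r; last first.
  rewrite mulrC; apply: smallMr; apply: small_le sm; exact: leq_maxr.
have y0 : 0 <= qseq y M by rewrite -(rmod_qseq hp y M); exact: rmod_ge0.
have [s [k ->]] := qrat_decomp (inZp1_qseq y M) y0.
by rewrite charMn mulrnAr PsiMn fa.
Qed.

End Characters.
End CharacteristicLike.

(** * The functional equations *)

Section LinearForms.
Variables (R : realType) (F : fieldType).
Implicit Types (f g h k : F -> R[i]) (x y z u v : F).

(* The alternating product of the hypothesis over the cube [{0,x} x {0,y} x {0,z}]
   cancels every factor that ignores one of the three variables. *)
Lemma third_difference f (G H L : F -> F -> R[i]) : f 0 = 1 ->
  (forall x y z, f (x + y + z) * G y z * H x z * L x y = 1) ->
  forall x y z, f (x + y + z) * f x * f y * f z = f (x + y) * f (x + z) * f (y + z).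
Proof.
move=> f0 E x y z.
have nz a b c : f (a + b + c) != 0 /\ [/\ G b c != 0, H a c != 0 & L a b != 0].
  have := oner_neq0 R[i]; rewrite -(E a b c) !mulf_eq0 !negb_or.
  by move=> /andP[/andP[/andP[]]].
have Gn b c : G b c != 0 by case: (nz 0 b c) => _ [].
have Hn a c : H a c != 0 by case: (nz a 0 c) => _ [].
have Ln a b : L a b != 0 by case: (nz a b 0) => _ [].
have e a b c : f (a + b + c) = (G b c * H a c * L a b)^-1.
  by apply/eqP; rewrite -[_^-1]mul1r -(E a b c); apply/eqP; field; rewrite Gn Hn Ln.
have e1 := e x 0 0; have e2 := e 0 y 0; have e3 := e 0 0 z.
have e12 := e x y 0; have e13 := e x 0 z; have e23 := e 0 y z.
have e0 := e 0 0 0.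
rewrite ?addr0 ?add0r in e1 e2 e3 e12 e13 e23 e0.
rewrite -[RHS]mulr1 -f0 e e1 e2 e3 e12 e13 e23 e0.
by field; rewrite !(Gn, Hn, Ln).
Qed.

(** The vector [(m2, - l2) / d2] is killed by the second form and has value [1] under the first;
    likewise with indices 3 and 4. At the combination of these vectors with coefficients [x], [y],
    [z] the first form is [x + y + z], while [g], [h], [k] do not see [x], [y], [z] respectively. *)
Lemma linear_forms_quadratic f g h k (l1 m1 l2 m2 l3 m3 l4 m4 : F) : f 0 = 1 ->
  l1 * m2 - m1 * l2 != 0 -> l1 * m3 - m1 * l3 != 0 -> l1 * m4 - m1 * l4 != 0 ->
  (forall u v, f (l1 * u + m1 * v) * g (l2 * u + m2 * v) *
               h (l3 * u + m3 * v) * k (l4 * u + m4 * v) = 1) ->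
  forall x y z, f (x + y + z) * f x * f y * f z = f (x + y) * f (x + z) * f (y + z).
Proof.
move=> f0 n2 n3 n4 E.
have {n2} [d2 e2 n2] : exists2 d, d = l1 * m2 - m1 * l2 & d != 0 
  by exists (l1 * m2 - m1 * l2); [reflexivity|exact n2].
have {n3} [d3 e3 n3] : exists2 d, d = l1 * m3 - m1 * l3 & d != 0 
  by exists (l1 * m3 - m1 * l3); [reflexivity|exact n3].
have {n4} [d4 e4 n4] : exists2 d, d = l1 * m4 - m1 * l4 & d != 0 
  by exists (l1 * m4 - m1 * l4); [reflexivity|exact n4].
apply: (third_difference f0
  (G := fun y z => g (y / d3 * (l2 * m3 - m2 * l3) + z / d4 * (l2 * m4 - m2 * l4)))
  (H := fun x z => h (x / d2 * (l3 * m2 - m3 * l2) + z / d4 * (l3 * m4 - m3 * l4)))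
  (L := fun x y => k (x / d2 * (l4 * m2 - m4 * l2) + y / d3 * (l4 * m3 - m4 * l3)))).
move=> x y z.
have := E (x / d2 * m2 + y / d3 * m3 + z / d4 * m4)
          (- (x / d2 * l2 + y / d3 * l3 + z / d4 * l4)).
have -> : l1 * (x / d2 * m2 + y / d3 * m3 + z / d4 * m4) +
    m1 * - (x / d2 * l2 + y / d3 * l3 + z / d4 * l4) = x + y + z.
  transitivity (x / d2 * (l1 * m2 - m1 * l2) + y / d3 * (l1 * m3 - m1 * l3) +
    z / d4 * (l1 * m4 - m1 * l4)); first by ring.
  by rewrite -e2 -e3 -e4 !divfK.
move=> <-; congr (_ * g _ * h _ * k _); ring.
Qed.

End LinearForms.

Section FunctionalEquations.
Variables (R : realType) (p : nat) (hp : prime p).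
Local Notation K := (Qpf hp).
Implicit Types (f g h : K -> R[i]) (x y z u v w : K).

Definition is_char f : Prop := exists a : K, forall y, f y = Psi R (a * y).

Lemma cflike_char f : cflike f -> {morph f : x y / x + y >-> x * y} -> is_char f.
Proof. exact: char_Psi. Qed.

(** Up to sign the pairwise determinants of the four forms are [1], [a2], [a3], [b2], [b3] and
    [a2 b3 - a3 b2], all nonzero, so each form can take the role of the first in
    [linear_forms_quadratic]. *)
Lemma char_of_independent_forms f1 f2 f3 f4 (a2 a3 b2 b3 : K) :
  cflike f1 -> cflike f2 -> cflike f3 -> cflike f4 ->
  a2 != 0 -> a3 != 0 -> b2 != 0 -> b3 != 0 -> a2 * b3 != a3 * b2 ->
  (forall u v, f1 u * f2 (a2 * u + b2 * v) * f3 (a3 * u + b3 * v) * f4 v = 1) ->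
  [/\ is_char f1, is_char f2, is_char f3 & is_char f4].
Proof.
move=> c1 c2 c3 c4 a20 a30 b20 b30 det E.
have d0 : a2 * b3 - b2 * a3 != 0 by rewrite subr_eq0 (mulrC b2).
have d0' : a3 * b2 - b3 * a2 != 0 by rewrite subr_eq0 (mulrC b3) eq_sym.
have E1 u v : f1 (1 * u + 0 * v) * f2 (a2 * u + b2 * v) * f3 (a3 * u + b3 * v) *
    f4 (0 * u + 1 * v) = 1 by rewrite !mul1r !mul0r addr0 add0r.
split; apply: cflike_char => //; apply: cflike_quadratic => //.
- by apply: linear_forms_quadratic (cflike0 c1) _ _ _ E1;
    rewrite ?mul1r ?mul0r ?subr0 ?oner_neq0.
- apply: (linear_forms_quadratic (g := f1) (h := f3) (k := f4) (m2 := 0) (l2 := 1)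
    (l3 := a3) (m3 := b3) (l4 := 0) (m4 := 1) (cflike0 c2) _ d0); last 1 first.
  + by move=> u v; rewrite -(E1 u v); ring.
  + by rewrite mulr0 mulr1 sub0r oppr_eq0.
  + by rewrite mulr0 mulr1 subr0.
- apply: (linear_forms_quadratic (g := f1) (h := f2) (k := f4) (m2 := 0) (l2 := 1)
    (l3 := a2) (m3 := b2) (l4 := 0) (m4 := 1) (cflike0 c3) _ d0'); last 1 first.
  + by move=> u v; rewrite -(E1 u v); ring.
  + by rewrite mulr0 mulr1 sub0r oppr_eq0.
  + by rewrite mulr0 mulr1 subr0.
- apply: (linear_forms_quadratic (l1 := 0) (m1 := 1) (g := f1) (h := f2) (k := f3) (m2 := 0) (l2 := 1)
    (l3 := a2) (m3 := b2) (l4 := a3) (m4 := b3) (cflike0 c4)); last 1 first.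
  + by move=> u v; rewrite -(E1 u v); ring.
  + by rewrite mulr0 mulr1 sub0r oppr_eq0 oner_neq0.
  + by rewrite mul0r mul1r sub0r oppr_eq0.
  + by rewrite mul0r mul1r sub0r oppr_eq0.
Qed.

Lemma small_expn (r : K) n : small 1 r -> small n (r ^+ n).
Proof.
have Pn0 : (p%:R : K) != 0 by exact: pnat_neq0.
move=> r1; have s0 : small 0 (r / p%:R).
  by rewrite -(small_mulX 0 1) expr1 add0n divfK.
have -> : r ^+ n = (r / p%:R) ^+ n * p%:R ^+ n by rewrite -exprMn divfK.
rewrite -[n in small n]add0n; apply/small_mulX.
elim: n => [|n IH]; first by rewrite expr0 -(expr0 p%:R); exact: smallX.
by rewrite exprS; apply: smallMr; rewrite (dexp_small0 IH).
Qed.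

Lemma cflike_alternating f (r : K) : cflike f -> small 1 r ->
  (forall w, f w * f (r * w) = 1) -> forall w, f w = 1.
Proof.
move=> cf r1 fr w.
have f2 y : f (r ^+ 2 * y) = f y.
  have n0 : f (r * y) != 0 by exact: (cflike_neq0 cf).
  apply: (mulfI n0); rewrite expr2 -(mulrA r r y) (fr (r * y)).
  by rewrite mulrC fr.
have f2n n : f (r ^+ (2 * n) * w) = f w.
  elim: n => [|n IH]; first by rewrite muln0 expr0 mul1r.
  by rewrite mulnS exprD -(mulrA (r ^+ 2)) f2.
apply: (@ccvg_uniq _ (fun n => f (r ^+ (2 * n) * w))).
  by apply: ccvg_eventually; exists 0%N => n _; exact: f2n.
rewrite -(cflike0 cf); apply: (cflike_cvg cf) => m; exists (m + dexp w)%N => n le.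
rewrite subr0; apply: smallMr; apply: small_le (small_expn (2 * n) r1).
by rewrite (leq_trans le) // mul2n -addnn leq_addr.
Qed.

(** For [d = c / (a + b)] the character [Psi (d w)] solves the same equation as [g], so the quotient
    [k] solves the equation with right-hand side [1], and [cflike_alternating] applies to it. *)
Lemma char_of_product g (a b c : K) : cflike g -> b != 0 -> small 1 (a / b) ->
  (forall w, g (b * w) * g (a * w) = Psi R (c * w)) -> is_char g.
Proof.
move=> cg b0; set r := a / b => r1 E.
(* Otherwise [r = -1], whose even powers are [1] and do not tend to [0]. *)
have ab0 : a + b != 0.
  apply/eqP => ab; have rN1 : r = -1.
    by rewrite /r; move/eqP: ab; rewrite addr_eq0 => /eqP ->; rewrite mulNr divff.
  have /eqP : (1 : K) = 0.
    apply: qseq_eq0 => n; have h := small_expn (n + n) r1.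
    have e : r ^+ (n + n) = 1 by rewrite rN1 -signr_odd addnn odd_double expr0.
    rewrite e in h; exact: (small_le (leq_addr n n) h).
  by rewrite oner_eq0.
pose d := c / (a + b); pose k w := g w * (Psi R (d * w))^-1.
have ck : cflike k by apply: cflikeM => //; apply: cflikeV; exact: cflike_Psi.
have kr w : k w * k (r * w) = 1.
  have := E (w / b); rewrite mulrCA divff // mulr1.
  have -> : a * (w / b) = r * w by rewrite /r; ring.
  have -> : c * (w / b) = d * w + d * (r * w).
    by rewrite /d /r; field; rewrite b0 ab0.
  rewrite PsiD /k => e; rewrite mulrACA e -invfM divff // mulf_neq0 ?Psi_neq0 //.
have k1 := cflike_alternating ck r1 kr.
exists d => w; have := k1 w; rewrite /k => e.
by rewrite -[LHS](divfK (Psi_neq0 R (d * w))) e mul1r.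
Qed.

Lemma is_charV f : is_char f -> is_char (fun x => (f x)^-1).
Proof.
move=> [a fa]; exists (- a) => y; rewrite fa (mulNr a y) (PsiN R (a * y)).
by apply: (mulfI (Psi_neq0 R (a * y))); rewrite divff ?PsiJ ?Psi_neq0.
Qed.

Lemma is_char_scale f a : is_char f -> is_char (fun x => f (a * x)).
Proof. by move=> [b fb]; exists (b * a) => y; rewrite fb mulrA. Qed.

(** With the common ratio [c = b2 / a2 = b3 / a3] the middle forms are [a2 (u + c v)] and
    [a3 (u + c v)]. Putting [v = 0] and [u = 0] expresses [f1] and [f4] through [G]; substituted
    back, the equation becomes multiplicativity of [G]. *)
Lemma char_of_dependent_forms f1 g f4 (a2 a3 b2 b3 : K) :
  cflike f1 -> cflike g -> cflike f4 ->
  a2 != 0 -> a3 != 0 -> b2 != 0 -> a2 * b3 = a3 * b2 ->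
  small 1 (a2 / a3) \/ small 1 (a3 / a2) ->
  (forall u v, f1 u * g (a2 * u + b2 * v) * g (a3 * u + b3 * v) * f4 v = 1) ->
  [/\ is_char f1, is_char g & is_char f4].
Proof.
move=> c1 cg c4 a20 a30 b20 det sm E.
pose G w := g (a2 * w) * g (a3 * w); pose c := b2 / a2.
have cG : cflike G by apply: cflikeM; exact: cflike_scale.
have EG u v : f1 u * G (u + c * v) * f4 v = 1.
  rewrite -(E u v) /G mulrA; congr (_ * g _ * g _ * _); rewrite /c; first by field.
  have -> : b3 = a3 * b2 / a2 by rewrite -det mulrC mulKf.
  by field.
have e1 u : f1 u = (G u)^-1.
  have := EG u 0; rewrite mulr0 addr0 (cflike0 c4) mulr1 => h.
  by apply: (mulIf (cflike_neq0 cG u)); rewrite h mulVf // (cflike_neq0 cG).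
have e4 v : f4 v = (G (c * v))^-1.
  have := EG 0 v; rewrite add0r (cflike0 c1) mul1r => h.
  by apply: (mulfI (cflike_neq0 cG (c * v))); rewrite h divff // (cflike_neq0 cG).
have c0 : c != 0 by rewrite mulf_neq0 ?invr_eq0.
have GD : {morph G : x y / x + y >-> x * y}.
  move=> x y; have cy : c * (y / c) = y by rewrite mulrC divfK.
  have := EG x (y / c); rewrite e4 e1 cy => h.
  have nG z : G z != 0 by exact: (cflike_neq0 cG).
  by rewrite -[RHS]mulr1 -h; field; rewrite !nG.
have [gam hgam] := cflike_char cG GD.
have chG : is_char G by exists gam.
split.
- have -> : f1 = fun u => (G u)^-1 by apply/funext.
  exact: is_charV.
- case: sm => sm.
    by apply: (char_of_product (c := gam) cg a30 sm) => w; rewrite mulrC -hgam.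
  by apply: (char_of_product (c := gam) cg a20 sm) => w; rewrite -hgam.
- have -> : f4 = fun v => (G (c * v))^-1 by apply/funext.
  by apply: is_charV; exact: is_char_scale.
Qed.

End FunctionalEquations.

(** * Complex expectations *)

Section ComplexExpectation.
Context {R : realType} {d : measure_display} {T : measurableType d} (P : probability T R).
Local Notation cRe := (@complex.Re R).
Local Notation cIm := (@complex.Im R).
Implicit Types (Z W : T -> R[i]) (M : R).

Definition cexp Z : R[i] :=
  ((\int[P]_t cRe (Z t))%R +i* (\int[P]_t cIm (Z t))%R)%C.

Definition bmeas M Z : Prop :=
  [/\ measurable_fun setT (fun t => cRe (Z t)), measurable_fun setT (fun t => cIm (Z t)) &
      forall t, `|Z t| <= M%:C%C].

(** Measurability for the discrete sigma-algebra on [C]: every function of [kappa] is then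
    measurable. For countable [C] it can be checked on fibres, by [dmeas_countable]. *)
Definition dmeas {C : Type} (kappa : T -> C) : Prop := forall A : set C, measurable (kappa @^-1` A).

Lemma cRe_bound (z : R[i]) M : `|z| <= M%:C%C -> `|cRe z| <= M.
Proof. by move=> h; rewrite -lecR (le_trans (normc_ge_Re z)). Qed.

Lemma cIm_bound (z : R[i]) M : `|z| <= M%:C%C -> `|cIm z| <= M.
Proof.
move=> h; rewrite -normrN -ReiNIm; apply: cRe_bound.
by rewrite normrM [X in _ * X]normc_def /= expr0n expr1n add0r sqrtr1 mulr1.
Qed.

Lemma bounded_integrable (f : T -> R) M : measurable_fun setT f -> (forall t, `|f t| <= M) ->
  P.-integrable setT (EFin \o f).
Proof.
move=> mf bf; apply: measurable_bounded_integrable => //.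
  by apply: le_lt_trans (probability_le1 P measurableT) _; rewrite ltry.
exists M; split; first exact: num_real.
by move=> x Mx t _ /=; exact: le_trans (bf t) (ltW Mx).
Qed.

Lemma bmeas_Re M Z : bmeas M Z -> P.-integrable setT (EFin \o (fun t => cRe (Z t))).
Proof. by move=> [m1 _ b]; apply: (@bounded_integrable _ M) => // t; exact: cRe_bound. Qed.

Lemma bmeas_Im M Z : bmeas M Z -> P.-integrable setT (EFin \o (fun t => cIm (Z t))).
Proof. by move=> [_ m2 b]; apply: (@bounded_integrable _ M) => // t; exact: cIm_bound. Qed.

Lemma bmeas_cst (c : R[i]) : bmeas (cRe `|c|) (fun _ => c).
Proof.
split; [exact: measurable_cst|exact: measurable_cst|move=> _].
by rewrite RRe_real ?normr_real.
Qed.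

Lemma bmeasD M N Z W : bmeas M Z -> bmeas N W -> bmeas (M + N) (fun t => Z t + W t).
Proof.
move=> [m1 m2 b] [n1 n2 c]; split.
- by under eq_fun do rewrite cReD; exact: measurable_funD.
- by under eq_fun do rewrite cImD; exact: measurable_funD.
- by move=> t; rewrite rmorphD /= (le_trans (ler_normD _ _)) // lerD.
Qed.

Lemma bmeasM M N Z W : bmeas M Z -> bmeas N W -> bmeas (M * N) (fun t => Z t * W t).
Proof.
move=> [m1 m2 b] [n1 n2 c]; split.
- under eq_fun do rewrite cReM; apply: measurable_funB; exact: measurable_funM.
- under eq_fun do rewrite cImM; apply: measurable_funD; exact: measurable_funM.
- by move=> t; rewrite rmorphM /= normrM ler_pM.
Qed.

Lemma dmeas_bmeas {C : Type} (kappa : T -> C) (h : C -> R[i]) M : dmeas kappa ->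
  (forall c, `|h c| <= M%:C%C) -> bmeas M (fun t => h (kappa t)).
Proof.
move=> mk hM; split=> // _ Y _; rewrite setTI.
  exact: (mk [set c | Y (cRe (h c))]).
exact: (mk [set c | Y (cIm (h c))]).
Qed.

Lemma bmeas_sum (I : Type) (r : seq I) (F : I -> T -> R[i]) (M : I -> R) :
  (forall i, bmeas (M i) (F i)) -> bmeas (\sum_(i <- r) M i) (fun t => \sum_(i <- r) F i t).
Proof.
move=> h; elim: r => [|i r IH].
  rewrite big_nil [X in bmeas _ X](_ : _ = fun=> 0); last by apply/funext => t; rewrite big_nil.
  by have := bmeas_cst 0; rewrite normr0.
rewrite big_cons [X in bmeas _ X](_ : _ = fun t => F i t + \sum_(j <- r) F j t).
  exact: bmeasD.
by apply/funext => t; rewrite big_cons.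
Qed.

Lemma cexp_cst (c : R[i]) : cexp (fun _ => c) = c.
Proof.
rewrite /cexp !Rintegral_cst //= [fine _](_ : _ = 1) ?mulr1; last by rewrite probability_setT.
by case: c.
Qed.

Lemma eq_cexp Z W : Z =1 W -> cexp Z = cexp W.
Proof. by move=> /funext ->. Qed.

Lemma cexpD M N Z W : bmeas M Z -> bmeas N W -> cexp (fun t => Z t + W t) = cexp Z + cexp W.
Proof.
move=> bZ bW; rewrite /cexp.
under eq_Rintegral do rewrite cReD; rewrite RintegralD //; [|exact: bmeas_Re bZ|exact: bmeas_Re bW].
under [X in (_ +i* X)%C]eq_Rintegral do rewrite cImD.
by rewrite RintegralD //; [exact: bmeas_Im bZ|exact: bmeas_Im bW].
Qed.

Lemma cexpZ M Z (c : R[i]) : bmeas M Z -> cexp (fun t => c * Z t) = c * cexp Z.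
Proof.
move=> bZ; have iR := bmeas_Re bZ; have iI := bmeas_Im bZ; case: bZ => mR mI b.
have iZ (f : T -> R) (a : R) : P.-integrable setT (EFin \o f) -> 
    P.-integrable setT (EFin \o (fun t => a * f t)).
  by move=> h; apply: (integrableZl measurableT a h).
rewrite /cexp; apply/eqP; rewrite eq_complex /=; apply/andP; split; apply/eqP.
  under eq_Rintegral do rewrite cReM.
  rewrite RintegralB ?RintegralZl //; [|exact: iZ|exact: iZ].
  by case: c.
under eq_Rintegral do rewrite cImM.
rewrite RintegralD ?RintegralZl //; [|exact: iZ|exact: iZ].
by case: c.
Qed.

Lemma cexp_sum (I : Type) (r : seq I) (F : I -> T -> R[i]) (M : I -> R) :
  (forall i, bmeas (M i) (F i)) ->
  cexp (fun t => \sum_(i <- r) F i t) = \sum_(i <- r) cexp (F i).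
Proof.
move=> h; elim: r => [|i r IH].
  by rewrite big_nil -[RHS]cexp_cst; apply: eq_cexp => t; rewrite big_nil.
rewrite big_cons -IH -(cexpD (h i) (bmeas_sum r h)).
by apply: eq_cexp => t; rewrite big_cons.
Qed.

Lemma Rint_eventually (f_ : nat -> T -> R) (f : T -> R) M :
  (forall n, measurable_fun setT (f_ n)) -> measurable_fun setT f ->
  (forall n t, `|f_ n t| <= M) ->
  (forall t, exists N, forall n, (N <= n)%N -> f_ n t = f t) ->
  (fun n => \int[P]_t f_ n t)%R @ \oo --> (\int[P]_t f t)%R.
Proof.
move=> mf_ mf b ev.
have [|||||if_ _] := @dominated_convergence _ _ _ P setT measurableT
   (fun n => EFin \o f_ n) (EFin \o f) (fun _ => M%:E).
- by move=> n; exact/measurable_EFinP.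
- exact/measurable_EFinP.
- apply: aeW => t _; apply: cvg_near_cst; have [N hN] := ev t.
  by exists N => // n /= /hN ->.
- exact: finite_measure_integrable_cst.
- by apply: aeW => t n _; rewrite /= lee_fin.
move=> h; apply: fine_cvg.
rewrite fineK; first exact: h.
exact: integrable_fin_num.
Qed.

(** Dominated convergence for sequences stationary at each point. Characters of [Q_p] are locally
    constant, so truncations, the continuity of characteristic functions and the averages [fejer]
    all have this form. *)
Lemma cexp_eventually (Z_ : nat -> T -> R[i]) Z M N :
  (forall n, bmeas M (Z_ n)) -> bmeas N Z ->
  (forall t, exists K, forall n, (K <= n)%N -> Z_ n t = Z t) ->
  ccvg (fun n => cexp (Z_ n)) (cexp Z).
Proof.
move=> bZ_ [mR mI _] ev; split => /=.
  apply: (@Rint_eventually _ _ M) => // [n|n t|t].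
  - by case: (bZ_ n).
  - by apply: cRe_bound; case: (bZ_ n).
  - by have [k hk] := ev t; exists k => n /hk ->.
apply: (@Rint_eventually _ _ M) => // [n|n t|t].
- by case: (bZ_ n).
- by apply: cIm_bound; case: (bZ_ n).
- by have [k hk] := ev t; exists k => n /hk ->.
Qed.

Lemma bmeas_ind (A : set T) : measurable A -> bmeas 1 (fun t => (t \in A)%:R).
Proof.
move=> mA; apply: (@dmeas_bmeas _ (fun t => t \in A) (fun b : bool => b%:R)); last first.
  by case; rewrite ?normr1 ?normr0.
move=> B; have -> : (fun t => t \in A) @^-1` B =
   (A `&` [set _ | B true]) `|` (~` A `&` [set _ | B false]).
  apply/seteqP; split=> t /=.
    have [tA|tA] := boolP (t \in A) => h; [left|right]; split=> //; first exact/set_mem.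
    by move/mem_set; rewrite (negbTE tA).
  move=> [[tA b]|[tA b]]; first by rewrite /preimage /= (mem_set tA).
  by rewrite /preimage /= (memNset tA).
have mc (Q : Prop) : measurable [set _ : T | Q].
  have [q|q] := pselect Q.
    by rewrite (_ : [set _ | Q] = setT) //; apply/seteqP; split.
  by rewrite (_ : [set _ | Q] = set0) //; apply/seteqP; split.
by apply: measurableU; apply: measurableI => //; exact: measurableC.
Qed.

Lemma cexp_ind (A : set T) : measurable A -> cexp (fun t => (t \in A)%:R) = (fine (P A))%:C%C.
Proof.
move=> mA; rewrite /cexp /Rintegral.
have -> : (fun t => (cIm ((t \in A)%:R))%:E) = cst 0%E.
  by apply/funext => t /=; case: (t \in A).
have -> : (fun t => (cRe ((t \in A)%:R))%:E) = (fun t => (\1_A t)%:E).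
  by apply/funext => t /=; rewrite indicE; case: (t \in A).
by rewrite integral0 integral_indic // setIT.
Qed.

End ComplexExpectation.

(** * Expectations of functions of countable-valued variables *)

Section DiscreteVariables.
Context {R : realType} {d : measure_display} {T : measurableType d} (P : probability T R).
Local Notation cRe := (@complex.Re R).
Local Notation cIm := (@complex.Im R).
Implicit Types (h : nat -> R[i]).

Lemma dmeas_countable (C : countType) (kappa : T -> C) :
  (forall c, measurable (kappa @^-1` [set c])) -> dmeas kappa.
Proof.
move=> mk A.
have -> : kappa @^-1` A =
    \bigcup_(k in [set k : nat | exists2 c, A c & pickle c = k])
      (fun t => pickle (kappa t)) @^-1` [set k].
  apply/seteqP; split=> t /=.
    by move=> At; exists (pickle (kappa t)) => //; exists (kappa t).
  by move=> [_ [c Ac <-]] /= /(pcan_inj pickleK) ->.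
apply: bigcup_measurable => k [c Ac <-].
rewrite (_ : _ @^-1` _ = kappa @^-1` [set c]) //.
by apply/seteqP; split=> t /= => [/(pcan_inj pickleK)|->].
Qed.

Lemma dmeas_comp (C D : Type) (kappa : T -> C) (g : C -> D) :
  dmeas kappa -> dmeas (fun t => g (kappa t)).
Proof. by move=> mk A; exact: (mk (g @^-1` A)). Qed.

Lemma dmeas_pair (C D : countType) (kappa : T -> C) (lambda : T -> D) :
  dmeas kappa -> dmeas lambda -> dmeas (fun t => (kappa t, lambda t)).
Proof.
move=> mk ml; apply: dmeas_countable => -[a b].
rewrite (_ : _ @^-1` _ = kappa @^-1` [set a] `&` lambda @^-1` [set b]); first exact: measurableI.
by apply/seteqP; split=> t /= [-> ->].
Qed.

Definition level (kappa : T -> nat) (k : nat) : T -> R[i] := fun t => (kappa t == k)%:R.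

Lemma level_ind (kappa : T -> nat) k :
  level kappa k = fun t => (t \in kappa @^-1` [set k])%:R.
Proof. by apply/funext => t; rewrite /level; congr ((nat_of_bool _)%:R); apply/idP/idP => [/eqP/mem_set|/set_mem/eqP]. Qed.

Lemma bmeas_level (kappa : T -> nat) k : dmeas kappa -> bmeas 1 (level kappa k).
Proof. by move=> mk; rewrite level_ind; apply: bmeas_ind; exact: mk. Qed.

Lemma cexp_level (kappa : T -> nat) k : dmeas kappa ->
  cexp P (level kappa k) = (fine (P (kappa @^-1` [set k])))%:C%C.
Proof. by move=> mk; rewrite level_ind cexp_ind. Qed.

(** Finite-valued approximation of [h (kappa t)]: its expectation is a finite sum over levels, and
    at each point it is eventually exact. *)
Definition trunc (kappa : T -> nat) h (N : nat) : T -> R[i] :=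
  fun t => \sum_(k <- iota 0 N) h k * level kappa k t.

Lemma truncE (kappa : T -> nat) h N t :
  trunc kappa h N t = if (kappa t < N)%N then h (kappa t) else 0.
Proof.
rewrite /trunc /level; case: ifPn => lt.
  rewrite (bigD1_seq (kappa t)) ?mem_iota ?iota_uniq //= eqxx mulr1 big1 ?addr0 // => k ne.
  by rewrite eq_sym (negbTE ne) mulr0.
rewrite big_seq big1 // => k; rewrite mem_iota add0n => /andP[_ kN].
by rewrite (_ : _ == _ = false) ?mulr0 //; apply/eqP => e; rewrite e kN in lt.
Qed.

Lemma bmeas_trunc (kappa : T -> nat) h M N : dmeas kappa ->
  (forall k, `|h k| <= M%:C%C) -> bmeas M (trunc kappa h N).
Proof.
move=> mk hM; have M0 : 0 <= M%:C%C by exact: le_trans (hM 0%N).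
rewrite (_ : trunc _ _ _ = fun t => (fun k => if (k < N)%N then h k else 0) (kappa t)); last first.
  by apply/funext => t; rewrite truncE.
by apply: (dmeas_bmeas (h := fun k => if (k < N)%N then h k else 0) mk) => k; case: ifP; rewrite ?normr0.
Qed.

Lemma trunc_eventually (kappa : T -> nat) h t :
  exists K, forall n, (K <= n)%N -> trunc kappa h n t = h (kappa t).
Proof. by exists (kappa t).+1 => n lt; rewrite truncE lt. Qed.

Lemma cexp_trunc (kappa : T -> nat) h N (W : T -> R[i]) M : dmeas kappa -> bmeas M W ->
  cexp P (fun t => trunc kappa h N t * W t) =
  \sum_(k <- iota 0 N) h k * cexp P (fun t => level kappa k t * W t).
Proof.
move=> mk bW.
have b k := bmeasM (bmeas_level k mk) bW.
under eq_bigr do rewrite -(cexpZ P _ (b _)).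
rewrite -(cexp_sum P (iota 0 N) (fun k => bmeasM (bmeas_cst (h k)) (b k))).
by apply: eq_cexp => t; rewrite /trunc mulr_suml; apply: eq_bigr => k _; rewrite mulrA.
Qed.

(** Factorisation passes from the indicators of the levels of [kappa] to truncations by linearity,
    then to [h (kappa t)] in the limit. Since [W] is arbitrary, several independent factors can be
    treated one at a time. *)
Lemma cexp_indep (kappa : T -> nat) h M (W : T -> R[i]) N (c : R[i]) : dmeas kappa ->
  (forall k, `|h k| <= M%:C%C) -> bmeas N W ->
  (forall k, cexp P (fun t => level kappa k t * W t) = cexp P (level kappa k) * c) ->
  cexp P (fun t => h (kappa t) * W t) = cexp P (fun t => h (kappa t)) * c.
Proof.
move=> mk hM bW ind.
have bh : bmeas M (fun t => h (kappa t)) by exact: dmeas_bmeas.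
have b1 : bmeas 1 (fun _ : T => 1 : R[i]).
  by have := @bmeas_cst R d T 1; rewrite normr1.
apply: (@ccvg_uniq _ (fun n => cexp P (fun t => trunc kappa h n t * W t))).
  apply: cexp_eventually (bmeasM bh bW) _ => [n|t].
    by apply: bmeasM bW; exact: (bmeas_trunc n mk hM).
  by have [K hK] := trunc_eventually kappa h t; exists K => n /hK ->.
have -> : (fun n => cexp P (fun t => trunc kappa h n t * W t)) =
          (fun n => cexp P (trunc kappa h n) * c).
  apply/funext => n; rewrite (cexp_trunc h n mk bW).
  have -> : cexp P (trunc kappa h n) = \sum_(k <- iota 0 n) h k * cexp P (level kappa k).
    transitivity (cexp P (fun t => trunc kappa h n t * 1)).
      by apply: eq_cexp => t; rewrite mulr1.
    rewrite (cexp_trunc h n mk b1); apply: eq_bigr => k _; congr (_ * _).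
    by apply: eq_cexp => t; rewrite mulr1.
  by rewrite mulr_suml; apply: eq_bigr => k _; rewrite ind mulrA.
apply: ccvgM; last exact: ccvg_cst.
apply: cexp_eventually bh _ => [n|t]; first exact: (bmeas_trunc n mk hM).
exact: trunc_eventually.
Qed.

Lemma cexpJ (Z : T -> R[i]) M : bmeas M Z -> cexp P (fun t => (Z t)^*%C) = (cexp P Z)^*%C.
Proof.
move=> bZ; rewrite /cexp /=; congr (_ +i* _)%C.
  by apply: eq_Rintegral => t _; case: (Z t).
rewrite -mulN1r -RintegralZl //; last exact: bmeas_Im bZ.
by apply: eq_Rintegral => t _; rewrite mulN1r; case: (Z t).
Qed.

End DiscreteVariables.

(** Both sides are the limit of the same partial sums of [h k] times the probability of level
    [k]. *)
Lemma cexp_same_law (R : realType) (d d' : measure_display) (T : measurableType d)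
  (T' : measurableType d') (P : probability T R) (P' : probability T' R)
  (kappa : T -> nat) (kappa' : T' -> nat) (h : nat -> R[i]) (M : R) :
  dmeas kappa -> dmeas kappa' -> (forall k, `|h k| <= M%:C%C) ->
  (forall k, P (kappa @^-1` [set k]) = P' (kappa' @^-1` [set k])) ->
  cexp P (fun t => h (kappa t)) = cexp P' (fun t => h (kappa' t)).
Proof.
move=> mk mk' hM e.
have lim (d0 : measure_display) (T0 : measurableType d0) (P0 : probability T0 R) (k0 : T0 -> nat) :
  dmeas k0 -> ccvg (fun n => \sum_(k <- iota 0 n) h k * (fine (P0 (k0 @^-1` [set k])))%:C%C)
                   (cexp P0 (fun t => h (k0 t))).
  move=> m0; have b1 : bmeas 1 (fun _ : T0 => 1 : R[i]).
    by have := @bmeas_cst R d0 T0 1; rewrite normr1.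
  have -> : (fun n => \sum_(k <- iota 0 n) h k * (fine (P0 (k0 @^-1` [set k])))%:C%C) =
      (fun n => cexp P0 (trunc k0 h n)).
    apply/funext => n; transitivity (cexp P0 (fun t => trunc k0 h n t * 1)); last first.
      by apply: eq_cexp => t; rewrite mulr1.
    rewrite (cexp_trunc P0 h n m0 b1); apply: eq_bigr => k _.
    by rewrite -cexp_level //; congr (_ * _); apply: eq_cexp => t; rewrite mulr1.
  apply: cexp_eventually (dmeas_bmeas m0 hM) _ => [n|t]; first exact: (bmeas_trunc n m0 hM).
  exact: trunc_eventually.
apply: ccvg_uniq (lim _ _ P _ mk) _.
by under eq_fun do under eq_bigr do rewrite e; exact: lim.
Qed.

(** * Characteristic functions of p-adic random variables *)

Section PadicVariables.
Context {R : realType} {p : nat} (hp : prime p).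
Local Notation K := (Qpf hp).
Context {d : measure_display} {T : measurableType d} (P : probability T R).
Implicit Types (X Y : T -> K).

(** Measurability tested on the coordinates [x_n], which have values in the countable set [rat]. It
    is equivalent to Borel measurability, by [measurable_levmeas] and [levmeas_measurable]. *)
Definition levmeas X : Prop := forall n, dmeas (fun t => qseq (X t) n).

Lemma measurable_ball n (A : set rat) : measurable ([set x : QpM p | A (qseq x n)]).
Proof.
rewrite (_ : [set x | _] = \bigcup_(r in A) [set x : QpM p | qseq x n = r]); last first.
  apply/seteqP; split=> x /=; first by move=> h; exists (qseq x n).
  by move=> [r Ar xr]; rewrite xr.
rewrite (_ : bigcup _ _ = \bigcup_(r : rat) (if `[< A r >] then [set x : QpM p | qseq x n = r] else set0)).
  apply: bigcupT_measurable_rat => r; case: ifP => // _.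
  by apply: sub_sigma_algebra; exists n, r.
apply/seteqP; split=> x /= [r]; first by move=> Ar xr; exists r => //; rewrite asboolT.
by move=> _; case: asboolP => // Ar xr; exists r.
Qed.

Lemma measurable_levmeas (X : T -> QpM p) : measurable_fun setT X -> levmeas X.
Proof.
by move=> mX n A; have := mX measurableT _ (measurable_ball n A); rewrite setTI.
Qed.

Lemma levmeas_measurable (X : T -> QpM p) : levmeas X -> measurable_fun setT X.
Proof.
move=> lX; apply: (@measurability _ _ T (QpM p) setT X (@qballs p)) => // _ [_ [n [r ->]] <-].
by rewrite setTI; exact: (lX n [set r]).
Qed.

Lemma levmeasD X Y : levmeas X -> levmeas Y -> levmeas (fun t => X t + Y t).
Proof.
move=> lX lY n.
have -> : (fun t => qseq (X t + Y t) n) =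
   fun t => (fun z => rmod (z.1 + z.2) (p%:R ^+ n)) (qseq (X t) n, qseq (Y t) n).
  apply/funext => t /=; rewrite -(rmod_qseq hp (X t + Y t) n).
  exact: (eqmp_rmod hp (qseqD (X t) (Y t) n)).
exact: (dmeas_comp (fun z => rmod (z.1 + z.2) (p%:R ^+ n)) (dmeas_pair (lX n) (lY n))).
Qed.

(** Coordinate [n] of [a x] is a function of coordinate [n + dexp a] of [x]. *)
Lemma levmeasM a X : levmeas X -> levmeas (fun t => a * X t).
Proof.
move=> lX n.
have -> : (fun t => qseq (a * X t) n) =
   fun t => (fun r => qseq (a * q_ hp r) n) (qseq (X t) (n + dexp a)).
  apply/funext => t /=; apply/(small_subP n (a * X t) (a * q_ hp (qseq (X t) (n + dexp a)))).
  rewrite -mulrBr mulrC; apply: smallMr; exact: small_sub_qrat.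
exact: (dmeas_comp (fun r => qseq (a * q_ hp r) n) (lX _)).
Qed.

Lemma levmeas_cst a : levmeas (fun _ => a).
Proof.
by move=> n A; rewrite preimage_cst; case: ifP.
Qed.

(** The character [x |-> Psi (x y)] is trivial on [p^n Z_p] once [n >= dexp y]. Its value at a
    random variable is therefore a function of one countable-valued coordinate. *)
Lemma Psi_level (x y : K) n : (dexp y <= n)%N -> Psi R (x * y) = Psi R (q_ hp (qseq x n) * y).
Proof.
move=> le; rewrite -[in LHS](subrK (q_ hp (qseq x n)) x) mulrDl PsiD Psi_small ?mul1r //.
apply: smallMr; apply: (small_le (m := n)) => //; exact: small_sub_qrat.
Qed.

Lemma Psi_norm_le (x : K) : `|Psi R x| <= 1%:C%C.
Proof. by rewrite Psi_norm. Qed.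

Lemma bmeas_Psi X y : levmeas X -> bmeas 1 (fun t => Psi R (X t * y)).
Proof.
move=> lX; rewrite (_ : (fun t => _) =
  fun t => (fun r => Psi R (q_ hp r * y)) (qseq (X t) (dexp y))); last first.
  by apply/funext => t; rewrite (Psi_level (X t) (leqnn (dexp y))).
apply: (dmeas_bmeas (h := fun r => Psi R (q_ hp r * y)) (lX (dexp y))) => r.
exact: Psi_norm_le.
Qed.

Definition cfun X (y : K) : R[i] := cexp P (fun t => Psi R (X t * y)).

Lemma cfun_neq0 X : levmeas X -> charfun_nonvanishing P X -> forall y, cfun X y != 0.
Proof.
move=> lX nv y; have b := bmeas_Psi y lX.
apply/eqP => /eqP; rewrite eq_complex /= => /andP[/eqP re0 /eqP im0].
have fR : ((\int[P]_t (complex.Re (Psi R (X t * y)))%:E) \is a fin_num)%E.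
  by apply: integrable_fin_num => //; exact: bmeas_Re b.
have fI : ((\int[P]_t (complex.Im (Psi R (X t * y)))%:E) \is a fin_num)%E.
  by apply: integrable_fin_num => //; exact: bmeas_Im b.
case: (nv y) => ne; apply: ne.
  by rewrite -[LHS]fineK // [X in X%:E]re0.
by rewrite -[LHS]fineK // [X in X%:E]im0.
Qed.

Lemma cfun_cflike X : levmeas X -> (forall y, cfun X y != 0) -> cflike (cfun X).
Proof.
move=> lX nz; split=> //.
- rewrite /cfun -[RHS](cexp_cst P); apply: eq_cexp => t; rewrite mulr0; exact: Psi0.
- move=> y; rewrite /cfun -(cexpJ P (bmeas_Psi y lX)); apply: eq_cexp => t.
  by rewrite mulrN; exact: PsiN.
- move=> u y uy; apply: cexp_eventually (bmeas_Psi y lX) _ => [n|t].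
    exact: bmeas_Psi.
  (* The threshold depends on [t], since convergence is not uniform in [X t]; stationarity at each
     [t] is enough. *)
  have [N hN] := uy (dexp (X t)); exists N => n /hN s.
  rewrite -(subrK y (u n)) mulrDr PsiD Psi_small ?mul1r // mulrC.
  exact: smallMr.
Qed.

Lemma cfun_shift X a y : levmeas X -> cfun (fun t => X t + a) y = Psi R (a * y) * cfun X y.
Proof.
move=> lX; rewrite /cfun -(cexpZ P _ (bmeas_Psi y lX)); apply: eq_cexp => t.
by rewrite mulrDl PsiD mulrC.
Qed.

(* An average over characters: by orthogonality of the [p^N]-th roots of unity, it is,
   for all large [N], the indicator of the ball [x_n = r]. *)
Definition fejer (n : nat) (r : rat) (N : nat) (x : K) : R[i] :=
  (p%:R ^+ N)^-1 * \sum_(j <- iota 0 (p ^ N)) e2pi R (- r / p%:R ^+ n) ^+ j *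
     Psi R (x * ((p%:R ^+ n)^-1 *+ j)).

Lemma pXC_neq0 N : (p%:R ^+ N : R[i]) != 0.
Proof. by rewrite expf_neq0 // pnatr_eq0 -lt0n prime_gt0. Qed.

Lemma fejer_geom n r N x :
  fejer n r N x = (p%:R ^+ N)^-1 * \sum_(j < p ^ N) e2pi R ((qseq x n - r) / p%:R ^+ n) ^+ j.
Proof.
rewrite /fejer -[in RHS](big_mkord xpredT (fun j => e2pi R ((qseq x n - r) / p%:R ^+ n) ^+ j)).
rewrite /index_iota subn0; congr (_ * _); apply: eq_bigr => j _.
rewrite mulrnAr PsiMn (Psi_divX R x (leqnn n)) -exprMn -e2piD; congr (e2pi R _ ^+ j); ring.
Qed.

(** For large [N] the average runs over the powers of a [p^N]-th root of unity, which equals [1]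
    only if [x_n] and [r] are congruent modulo [p^n]. As [r] is a canonical representative,
    congruence means equality. *)
Lemma fejer_eventually n r x : (exists z : K, qseq z n = r) ->
  exists N0, forall N, (N0 <= N)%N -> fejer n r N x = (qseq x n == r)%:R.
Proof.
move=> [z zr]; set w := (qseq x n - r) / p%:R ^+ n.
have [k hk] : inZp1 p w.
  have [k hk] : inZp1 p (qseq x n - r).
    by apply: inZp1D; [|apply: inZp1N; rewrite -zr]; exact: inZp1_qseq.
  by exists (n + k)%N; rewrite exprD /w mulrA divfK ?pX_neq0.
exists k => N kN; rewrite fejer_geom -/w.
have [xr|xr] := eqVneq (qseq x n) r.
  rewrite /w xr subrr mul0r e2pi0; under eq_bigr do rewrite expr1n.
  by rewrite sumr_const card_ord natrX mulVf ?pXC_neq0.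
have w1 : e2pi R w != 1.
  apply/eqP => /e2pi_eq1 wi; move/eqP: xr; apply; rewrite -zr.
  by apply: (eqmp_qseq_eq hp); rewrite /eqmp zr.
have := subrX1 (e2pi R w) (p ^ N).
have -> : e2pi R w ^+ (p ^ N) = 1.
  rewrite -e2piMn e2pi_int // -mulr_natr natrX -(subnKC kN) exprD mulrA.
  by rewrite rpredM // pX_int.
rewrite subrr => /esym/eqP; rewrite mulf_eq0 subr_eq0 (negbTE w1) /= => /eqP ->.
by rewrite mulr0.
Qed.

(** An inversion formula: integrating [fejer], which is bounded by [1], writes the probability of a
    ball as a limit of finite combinations of values of the characteristic function. *)
Lemma cfun_ball X n r : levmeas X -> (exists z : K, qseq z n = r) ->
  ccvg (fun N => (p%:R ^+ N)^-1 * \sum_(j <- iota 0 (p ^ N)) e2pi R (- r / p%:R ^+ n) ^+ j *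
     cfun X ((p%:R ^+ n)^-1 *+ j)) (fine (P [set t | qseq (X t) n = r]))%:C%C.
Proof.
move=> lX ex.
have mA : measurable [set t | qseq (X t) n = r] by exact: (lX n [set r]).
rewrite -(cexp_ind P mA).
have bj j : bmeas _ (fun t => e2pi R (- r / p%:R ^+ n) ^+ j * Psi R (X t * ((p%:R ^+ n)^-1 *+ j))) :=
  bmeasM (bmeas_cst (e2pi R (- r / p%:R ^+ n) ^+ j)) (bmeas_Psi ((p%:R ^+ n)^-1 *+ j) lX).
have -> : (fun N => (p%:R ^+ N)^-1 * \sum_(j <- iota 0 (p ^ N)) e2pi R (- r / p%:R ^+ n) ^+ j *
     cfun X ((p%:R ^+ n)^-1 *+ j)) = (fun N => cexp P (fun t => fejer n r N (X t))).
  apply/funext => N; rewrite /fejer (cexpZ P _ (bmeas_sum (iota 0 (p ^ N)) bj)).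
  rewrite (cexp_sum P (iota 0 (p ^ N)) bj); congr (_ * _); apply: eq_bigr => j _.
  by rewrite -(cexpZ P _ (bmeas_Psi _ lX)).
apply: (@cexp_eventually _ _ _ P _ _ 1 1) => [N||t]; last 2 first.
- exact: bmeas_ind.
- have [K0 hK] := fejer_eventually (X t) ex; exists K0 => N /hK ->.
  by congr ((nat_of_bool _)%:R); apply/idP/idP => [/eqP/mem_set|/set_mem/eqP].
  rewrite (_ : (fun t => _) = fun t => (fun s => (p%:R ^+ N)^-1 *
     \sum_(j < p ^ N) e2pi R ((rmod s (p%:R ^+ n) - r) / p%:R ^+ n) ^+ j) (qseq (X t) n)); last first.
    by apply/funext => t; rewrite fejer_geom rmod_qseq.
  apply: (dmeas_bmeas (h := fun s => (p%:R ^+ N)^-1 *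
     \sum_(j < p ^ N) e2pi R ((rmod s (p%:R ^+ n) - r) / p%:R ^+ n) ^+ j) (lX n)) => s.
  rewrite normrM normfV normrX normr_nat.
  rewrite ler_pdivrMl ?exprn_gt0 ?ltr0n ?prime_gt0 // mulr1.
  apply: le_trans (ler_norm_sum _ _ _) _.
  under eq_bigr do rewrite normrX e2pi_norm expr1n.
  by rewrite sumr_const card_ord natrX.
Qed.

End PadicVariables.

Arguments levmeas {p} hp {d T} X.
Arguments cfun {R p} hp {d T} P X y.
Arguments measurable_levmeas {p} hp {d T X} _.
Arguments levmeas_measurable {p} hp {d T X} _.

(** * Laws and characteristic functions, for one variable and for pairs *)

Section Uniqueness.
Context {R : realType} {p : nat} (hp : prime p).
Context {d d' : measure_display} {T : measurableType d} {T' : measurableType d'}.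
Variables (P : probability T R) (P' : probability T' R).

(** By [cfun_ball] the two laws agree on balls. Two balls are nested or disjoint, so balls are
    stable under intersection and, as they generate the sigma-algebra, determine a finite
    measure. *)
Lemma cfun_same_law (X : T -> QpM p) (Y : T' -> QpM p) :
  measurable_fun setT X -> measurable_fun setT Y ->
  (forall y, cfun hp P X y = cfun hp P' Y y) -> same_law P X P' Y.
Proof.
move=> mX mY e.
have lX := measurable_levmeas hp mX; have lY := measurable_levmeas hp mY.
have ball n r : P (X @^-1` [set x | qseq x n = r]) = P' (Y @^-1` [set x | qseq x n = r]).
  have [ex|nex] := pselect (exists z : Qpf hp, qseq z n = r); last first.
    have e0 : [set x : QpM p | qseq x n = r] = set0.
      by apply/seteqP; split=> z //= zr; apply: nex; exists z.
    by rewrite e0 !preimage_set0 !measure0.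
  have cX := cfun_ball P lX ex; have cY := cfun_ball P' lY ex.
  have fe := ccvg_uniq cX _.
  have {fe} : (fine (P (X @^-1` [set x | qseq x n = r])))%:C%C =
              (fine (P' (Y @^-1` [set x | qseq x n = r])))%:C%C :> R[i].
    by apply: fe; under eq_fun do under eq_bigr do rewrite e; exact: cY.
  move=> /complexI fe.
  rewrite -[LHS]fineK ?fe ?fineK //; apply: fin_num_measure.
    by rewrite -[X in measurable X]setTI; apply: mY => //; exact: (measurable_ball n [set r]).
  by rewrite -[X in measurable X]setTI; apply: mX => //; exact: (measurable_ball n [set r]).
(* A countable cover by balls of finite measure, for [measure_unique]; indices that decode to
   nothing repeat the ball [x_0 = 0]. *)
pose g (k : nat) : set (QpM p) := [set x | qseq x 0 = odflt 0 (unpickle k)].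
have Gg k : @qballs p (g k) by exists 0%N, (odflt 0 (unpickle k)).
have cov : \bigcup_k g k = setT.
  apply/seteqP; split=> // x _; exists (pickle (qseq x 0)) => //.
  by rewrite /g /= pickleK.
have setI : setI_closed (@qballs p).
  have le n m r s : (n <= m)%N ->
     @qballs p ([set x | qseq x n = r] `&` [set x | qseq x m = s]).
    move=> nm; have [[z [zn zm]]|no] := pselect (exists z : Qp p, qseq z n = r /\ qseq z m = s).
      exists m, s; apply/seteqP; split=> x /=; first by case.
      move=> xm; split=> //; rewrite -zn; apply: (eqmp_qseq_eq hp).
      apply: eqmp_trans (eqmp_sym (eqmp_qseq hp x nm)) _; rewrite xm -zm.
      exact: eqmp_qseq.
    (* The empty intersection must itself be exhibited as a ball: [x_0 = 1] is impossible, because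
       [x_0] lies in [[0, 1)]. *)
    exists 0%N, 1; apply/seteqP; split=> x /=; first by move=> [xn xm]; case: no; exists x.
    move=> x1; have := rmod_qseq hp x 0; rewrite x1 /rmod expr0 divr1 floor1 subrr => /eqP.
    by rewrite eq_sym oner_eq0.
  move=> _ _ [n [r ->]] [m [s ->]]; have [nm|mn] := leqP n m; first exact: le.
  by rewrite setIC; apply: le; exact: ltnW.
pose m1 : {measure set (QpM p) -> \bar R} := pushforward P X.
pose m2 : {measure set (QpM p) -> \bar R} := pushforward P' Y.
move=> A mA.
have balls B : @qballs p B -> m1 mX B = m2 mY B by move=> [n [r ->]]; exact: ball.
have fin k : (m1 mX (g k) < +oo)%E.
  apply: le_lt_trans (probability_le1 P _) (ltry _).
  by rewrite -[X in measurable X]setTI; apply: (mX) => //; exact: (measurable_ball 0 [set _]).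
exact: (@measure_unique _ R (QpM p) (@qballs p) g erefl setI Gg cov (m1 mX) (m2 mY) balls fin A mA).
Qed.

(** For [n] at least [dexp u] and [dexp v] the integrand depends only on the pair of coordinates of
    index [n], encoded as a natural number. The levels of this code are empty or products of two
    balls, hence events for the joint law. *)
Lemma cexp_joint_law (X1 X2 : T -> QpM p) (Y1 Y2 : T' -> QpM p) (u v : Qpf hp) :
  levmeas hp X1 -> levmeas hp X2 -> levmeas hp Y1 -> levmeas hp Y2 ->
  same_law P (fun t => (X1 t, X2 t) : QpM p * QpM p) P' (fun t => (Y1 t, Y2 t)) ->
  cexp P (fun t => Psi R (u * (X1 t : Qpf hp) + v * (X2 t : Qpf hp))) =
  cexp P' (fun t => Psi R (u * (Y1 t : Qpf hp) + v * (Y2 t : Qpf hp))).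
Proof.
move=> l1 l2 k1 k2 law; pose n := maxn (dexp u) (dexp v).
pose code (x y : Qpf hp) : nat := pickle (qseq x n, qseq y n).
pose h (k : nat) : R[i] := if unpickle k is Some rs then
  Psi R (u * q_ hp rs.1 + v * q_ hp rs.2) else 0.
have hE x y : Psi R (u * x + v * y) = h (code x y).
  have un : (dexp u <= n)%N by rewrite leq_max leqnn.
  have vn : (dexp v <= n)%N by rewrite leq_max leqnn orbT.
  rewrite /h /code pickleK /= (PsiD R (u * x) (v * y)).
  rewrite (PsiD R (u * q_ hp (qseq x n)) (v * q_ hp (qseq y n))).
  rewrite (mulrC u x) (mulrC v y) (mulrC u (q_ hp _)) (mulrC v (q_ hp _)).
  by rewrite (Psi_level x un) (Psi_level y vn).
have -> : (fun t => Psi R (u * (X1 t : Qpf hp) + v * (X2 t : Qpf hp))) =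
   fun t => h (code (X1 t) (X2 t)) by apply/funext => t.
have -> : (fun t => Psi R (u * (Y1 t : Qpf hp) + v * (Y2 t : Qpf hp))) =
   fun t => h (code (Y1 t) (Y2 t)) by apply/funext => t.
apply: (cexp_same_law (M := 1)).
- by apply: (dmeas_comp pickle); apply: dmeas_pair; [exact: l1|exact: l2].
- by apply: (dmeas_comp pickle); apply: dmeas_pair; [exact: k1|exact: k2].
- move=> k; rewrite /h; case: unpickle => [[r s]|]; first exact: Psi_norm_le.
  by rewrite normr0 lecR.
- move=> k; pose A : set (QpM p * QpM p) := [set z | code z.1 z.2 = k].
  apply: (law A).
  have [[rs ers]|no] := pselect (exists rs : rat * rat, pickle rs = k); last first.
    rewrite (_ : A = set0) //; apply/seteqP; split=> z //= h0; apply: no.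
    by exists (qseq z.1 n, qseq z.2 n).
  rewrite (_ : A = (fst @^-1` [set x : QpM p | qseq x n = rs.1]) `&`
                   (snd @^-1` [set x : QpM p | qseq x n = rs.2])).
    apply: measurableI; rewrite -[X in measurable X]setTI.
      by apply: measurable_fst => //; exact: (measurable_ball n [set rs.1]).
    by apply: measurable_snd => //; exact: (measurable_ball n [set rs.2]).
  apply/seteqP; split=> z; rewrite /A /code /= -ers.
    by move=> /(pcan_inj pickleK) <-.
  by move=> [-> ->]; case: rs {ers}.
Qed.

End Uniqueness.

(** * Independence and products of characteristic functions *)

Section Independence.
Context {R : realType} {p : nat} (hp : prime p).
Context {d : measure_display} {T : measurableType d} (P : probability T R).
Local Notation K := (Qpf hp).

(** Independence gives the product formula [E0] for indicators of levels. From [S1] to [S4], one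
    indicator at a time is moved to the front and replaced by a character through [cexp_indep], the
    other three factors forming [W]. *)
Lemma cexp_indep4 (X1 X2 X3 X4 : T -> QpM p) (y1 y2 y3 y4 : K) :
  measurable_fun setT X1 -> measurable_fun setT X2 ->
  measurable_fun setT X3 -> measurable_fun setT X4 ->
  indep4 P X1 X2 X3 X4 ->
  cexp P (fun t => Psi R ((X1 t : K) * y1) * Psi R ((X2 t : K) * y2) *
                   Psi R ((X3 t : K) * y3) * Psi R ((X4 t : K) * y4)) =
  cfun hp P X1 y1 * cfun hp P X2 y2 * cfun hp P X3 y3 * cfun hp P X4 y4.
Proof.
move=> m1 m2 m3 m4 ind.
have [l1 l2 l3 l4] : [/\ levmeas hp X1, levmeas hp X2, levmeas hp X3 & levmeas hp X4].
  by split; exact: measurable_levmeas.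
pose code (X : T -> QpM p) (y : K) t : nat := pickle (qseq (X t) (dexp y)).
pose h (y : K) (k : nat) : R[i] := if unpickle k is Some r then Psi R (q_ hp r * y) else 0.
have hE (X : T -> QpM p) y t : Psi R ((X t : K) * y) = h y (code X y t).
  by rewrite /h /code pickleK; apply: Psi_level.
have hM y k : `|h y k| <= 1%:C%C.
  by rewrite /h; case: unpickle => [r|]; [exact: Psi_norm_le|rewrite normr0 lecR].
have dc X y : levmeas hp X -> dmeas (code X y).
  by move=> lX; apply: (dmeas_comp pickle); exact: lX.
have mc (X : T -> QpM p) y k : exists2 A : set (QpM p), measurable A &
    code X y @^-1` [set k] = X @^-1` A.
  exists [set x | pickle (qseq x (dexp y)) = k] => //.
  exact: (measurable_ball (dexp y) [set r | pickle r = k]).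
have b X y k : levmeas hp X -> bmeas (1 : R) (level (code X y) k).
  by move=> lX; apply: bmeas_level; exact: dc.
have bh X y : levmeas hp X -> bmeas (1 : R) (fun t => h y (code X y t)).
  by move=> lX; apply: (dmeas_bmeas (dc X y lX)) => k; exact: hM.
pose c1 := code X1 y1; pose c2 := code X2 y2; pose c3 := code X3 y3; pose c4 := code X4 y4.
have E0 k1 k2 k3 k4 : cexp P (fun t => level c1 k1 t * (level c2 k2 t * (level c3 k3 t * level c4 k4 t))) =
   cexp P (level c1 k1) * (cexp P (level c2 k2) * (cexp P (level c3 k3) * cexp P (level c4 k4))).
  have [A1 mA1 e1] : exists2 A : set (QpM p), measurable A & c1 @^-1` [set k1] = X1 @^-1` A := mc X1 y1 k1.
  have [A2 mA2 e2] : exists2 A : set (QpM p), measurable A & c2 @^-1` [set k2] = X2 @^-1` A := mc X2 y2 k2.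
  have [A3 mA3 e3] : exists2 A : set (QpM p), measurable A & c3 @^-1` [set k3] = X3 @^-1` A := mc X3 y3 k3.
  have [A4 mA4 e4] : exists2 A : set (QpM p), measurable A & c4 @^-1` [set k4] = X4 @^-1` A := mc X4 y4 k4.
  have mp (X : T -> QpM p) A : measurable_fun setT X -> measurable A -> measurable (X @^-1` A).
    by move=> mX mA; rewrite -[X in measurable X]setTI; exact: mX.
  have mB1 := mp X1 A1 m1 mA1; have mB2 := mp X2 A2 m2 mA2.
  have mB3 := mp X3 A3 m3 mA3; have mB4 := mp X4 A4 m4 mA4.
  have fin B : measurable B -> P B \is a fin_num by move=> mB; exact: fin_num_measure.
  transitivity (cexp P (fun t => (t \in X1 @^-1` A1 `&` X2 @^-1` A2 `&` X3 @^-1` A3 `&` X4 @^-1` A4)%:R)).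
    by apply: eq_cexp => t; rewrite !level_ind e1 e2 e3 e4 !in_setI -!mulnb !natrM !mulrA.
  rewrite cexp_ind; last by do 3?[apply: measurableI => //].
  rewrite (cexp_level P k1 (dc X1 y1 l1)) (cexp_level P k2 (dc X2 y2 l2)).
  rewrite (cexp_level P k3 (dc X3 y3 l3)) (cexp_level P k4 (dc X4 y4 l4)).
  rewrite (_ : code X1 y1 @^-1` [set k1] = X1 @^-1` A1) // (_ : code X2 y2 @^-1` [set k2] = X2 @^-1` A2) //.
  rewrite (_ : code X3 y3 @^-1` [set k3] = X3 @^-1` A3) // (_ : code X4 y4 @^-1` [set k4] = X4 @^-1` A4) //.
  rewrite ind // !fineM ?fin_numM ?fin //.
  by rewrite !rmorphM /= !mulrA.
have bl1 k := b X1 y1 k l1; have bl2 k := b X2 y2 k l2.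
have bl3 k := b X3 y3 k l3; have bl4 k := b X4 y4 k l4.
have bh1 := bh X1 y1 l1; have bh2 := bh X2 y2 l2; have bh3 := bh X3 y3 l3.
pose h1 t := h y1 (c1 t); pose h2 t := h y2 (c2 t).
pose h3 t := h y3 (c3 t); pose h4 t := h y4 (c4 t).
have S1 k2 k3 k4 : cexp P (fun t => h1 t * (level c2 k2 t * (level c3 k3 t * level c4 k4 t))) =
   cexp P h1 * (cexp P (level c2 k2) * (cexp P (level c3 k3) * cexp P (level c4 k4))).
  apply: cexp_indep (dc X1 y1 l1) (hM y1) (bmeasM (bl2 k2) (bmeasM (bl3 k3) (bl4 k4))) _ => k1.
  exact: E0.
have S2 k3 k4 : cexp P (fun t => h2 t * (h1 t * (level c3 k3 t * level c4 k4 t))) =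
   cexp P h2 * (cexp P h1 * (cexp P (level c3 k3) * cexp P (level c4 k4))).
  apply: cexp_indep (dc X2 y2 l2) (hM y2) (bmeasM bh1 (bmeasM (bl3 k3) (bl4 k4))) _ => k2.
  by rewrite mulrCA -S1; apply: eq_cexp => t; rewrite mulrCA.
have S3 k4 : cexp P (fun t => h3 t * (h2 t * (h1 t * level c4 k4 t))) =
   cexp P h3 * (cexp P h2 * (cexp P h1 * cexp P (level c4 k4))).
  apply: cexp_indep (dc X3 y3 l3) (hM y3) (bmeasM bh2 (bmeasM bh1 (bl4 k4))) _ => k3.
  rewrite mulrCA [X in _ * X]mulrCA -S2; apply: eq_cexp => t.
  by rewrite mulrCA [X in _ * X]mulrCA.
have S4 : cexp P (fun t => h4 t * (h3 t * (h2 t * h1 t))) =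
   cexp P h4 * (cexp P h3 * (cexp P h2 * cexp P h1)).
  apply: cexp_indep (dc X4 y4 l4) (hM y4) (bmeasM bh3 (bmeasM bh2 bh1)) _ => k4.
  rewrite mulrC -!mulrA -S3; apply: eq_cexp => t.
  by rewrite mulrC -!mulrA.
have cfE (X : T -> QpM p) y : cfun hp P X y = cexp P (fun t => h y (code X y t)).
  by apply: eq_cexp => t; rewrite hE.
rewrite !cfE -/c1 -/c2 -/c3 -/c4 -/h1 -/h2 -/h3 -/h4.
transitivity (cexp P (fun t => h4 t * (h3 t * (h2 t * h1 t)))).
  apply: eq_cexp => t; rewrite !hE -/(h1 t) -/(h2 t) -/(h3 t) -/(h4 t).
  by move: (h1 t) (h2 t) (h3 t) (h4 t) => a1 a2 a3 a4; ring.
rewrite S4; move: (cexp P h1) (cexp P h2) (cexp P h3) (cexp P h4) => a1 a2 a3 a4.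
by ring.
Qed.

End Independence.

(** * From linear forms to the functional equation, and from characters back to shifts *)

Section Determination.
Context {R : realType} {p : nat} (hp : prime p).
Local Notation K := (Qpf hp).

Lemma same_law_cfun (d d' : measure_display) (T : measurableType d) (T' : measurableType d')
  (P : probability T R) (P' : probability T' R) (X : T -> QpM p) (Y : T' -> QpM p) (y : K) :
  measurable_fun setT X -> measurable_fun setT Y -> same_law P X P' Y ->
  cfun hp P X y = cfun hp P' Y y.
Proof.
move=> mX mY law; have lX := measurable_levmeas hp mX; have lY := measurable_levmeas hp mY.
pose h (k : nat) : R[i] := if unpickle k is Some r then Psi R (q_ hp r * y) else 0.
pose code (x : K) : nat := pickle (qseq x (dexp y)).
have hE x : Psi R (x * y) = h (code x).
  by rewrite /h /code pickleK; apply: Psi_level.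
transitivity (cexp P (fun t => h (code (X t)))); first by apply: eq_cexp => t; rewrite hE.
transitivity (cexp P' (fun t => h (code (Y t)))); last by apply: eq_cexp => t; rewrite hE.
apply: (cexp_same_law (M := 1)).
- by apply: (dmeas_comp pickle); exact: lX.
- by apply: (dmeas_comp pickle); exact: lY.
- move=> k; rewrite /h; case: unpickle => [r|]; first exact: Psi_norm_le.
  by rewrite normr0 lecR.
- move=> k; apply: (law [set x | code x = k]).
  exact: (measurable_ball (dexp y) [set r | pickle r = k]).
Qed.

Lemma cexp_linear_forms (d : measure_display) (T : measurableType d) (P : probability T R)
  (X1 X2 X3 X4 : T -> QpM p) (a2 a3 b2 b3 u v : K) :
  measurable_fun setT X1 -> measurable_fun setT X2 ->
  measurable_fun setT X3 -> measurable_fun setT X4 -> indep4 P X1 X2 X3 X4 ->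
  cexp P (fun t => Psi R (u * ((X1 t : K) + a2 * (X2 t : K) + a3 * (X3 t : K)) +
                          v * (b2 * (X2 t : K) + b3 * (X3 t : K) + (X4 t : K)))) =
  cfun hp P X1 u * cfun hp P X2 (a2 * u + b2 * v) * cfun hp P X3 (a3 * u + b3 * v) *
  cfun hp P X4 v.
Proof.
move=> m1 m2 m3 m4 ind; rewrite -(cexp_indep4 _ _ _ _ m1 m2 m3 m4 ind).
apply: eq_cexp => t; rewrite -!PsiD; congr (Psi R _).
move: (X1 t : K) (X2 t : K) (X3 t : K) (X4 t : K) => x1 x2 x3 x4; ring.
Qed.

Lemma levmeas_linear_form (d : measure_display) (T : measurableType d)
  (X Y Z : T -> QpM p) (a b c : K) :
  measurable_fun setT X -> measurable_fun setT Y -> measurable_fun setT Z ->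
  levmeas hp (fun t => a * (X t : K) + b * (Y t : K) + c * (Z t : K)).
Proof.
move=> mX mY mZ.
have lX := measurable_levmeas hp mX; have lY := measurable_levmeas hp mY.
have lZ := measurable_levmeas hp mZ.
exact: (levmeasD (levmeasD (levmeasM a lX) (levmeasM b lY)) (levmeasM c lZ)).
Qed.

Variables (d d' : measure_display) (T : measurableType d) (T' : measurableType d').
Variables (P : probability T R) (P' : probability T' R).

Definition cfratio (X : T -> QpM p) (Y : T' -> QpM p) (y : K) : R[i] :=
  cfun hp P' Y y * (cfun hp P X y)^-1.

Lemma cfratio_cflike X Y : measurable_fun setT X -> measurable_fun setT Y ->
  charfun_nonvanishing P X -> charfun_nonvanishing P' Y -> cflike (cfratio X Y).
Proof.
move=> mX mY nX nY; have lX := measurable_levmeas hp mX; have lY := measurable_levmeas hp mY.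
apply: cflikeM; first exact: cfun_cflike lY (cfun_neq0 lY nY).
exact: cflikeV (cfun_cflike lX (cfun_neq0 lX nX)).
Qed.

(** If the quotient is [Psi (a y)], the characteristic function of [Y] is that of [X + a], and
    uniqueness applies; the shift is thus the parameter of the character. *)
Lemma cfratio_shift X Y : measurable_fun setT X -> measurable_fun setT Y ->
  charfun_nonvanishing P X -> is_char (cfratio X Y) ->
  exists alpha : Qp p, same_law P' Y P (fun t => qadd (X t) alpha : QpM p).
Proof.
move=> mX mY nX [a ha]; exists a; have lX := measurable_levmeas hp mX.
have lXa : levmeas hp (fun t => (X t : K) + a) by apply: levmeasD lX _; exact: levmeas_cst.
apply: (cfun_same_law (hp := hp) mY); first exact: (levmeas_measurable hp lXa).
move=> y; rewrite [RHS](cfun_shift P a y lX) -ha /cfratio divfK //.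
exact: cfun_neq0.
Qed.

Lemma cfratio_equation (X1 X2 X3 X4 : T -> QpM p) (Y1 Y2 Y3 Y4 : T' -> QpM p)
  (a2 a3 b2 b3 : K) :
  measurable_fun setT X1 -> measurable_fun setT X2 ->
  measurable_fun setT X3 -> measurable_fun setT X4 -> indep4 P X1 X2 X3 X4 ->
  charfun_nonvanishing P X1 -> charfun_nonvanishing P X2 ->
  charfun_nonvanishing P X3 -> charfun_nonvanishing P X4 ->
  measurable_fun setT Y1 -> measurable_fun setT Y2 ->
  measurable_fun setT Y3 -> measurable_fun setT Y4 -> indep4 P' Y1 Y2 Y3 Y4 ->
  same_law P'
    (fun t => ((Y1 t : K) + a2 * (Y2 t : K) + a3 * (Y3 t : K),
               b2 * (Y2 t : K) + b3 * (Y3 t : K) + (Y4 t : K)) : QpM p * QpM p) P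
    (fun t => ((X1 t : K) + a2 * (X2 t : K) + a3 * (X3 t : K),
               b2 * (X2 t : K) + b3 * (X3 t : K) + (X4 t : K))) ->
  forall u v, cfratio X1 Y1 u * cfratio X2 Y2 (a2 * u + b2 * v) *
    cfratio X3 Y3 (a3 * u + b3 * v) * cfratio X4 Y4 v = 1.
Proof.
move=> mX1 mX2 mX3 mX4 iX n1 n2 n3 n4 mY1 mY2 mY3 mY4 iY law u v.
have form1 (d0 : measure_display) (T0 : measurableType d0) (Z1 Z2 Z3 : T0 -> QpM p) :
    measurable_fun setT Z1 -> measurable_fun setT Z2 -> measurable_fun setT Z3 ->
    levmeas hp (fun t => (Z1 t : K) + a2 * (Z2 t : K) + a3 * (Z3 t : K)).
  move=> k1 k2 k3; have := levmeas_linear_form 1 a2 a3 k1 k2 k3.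
  by under [X in levmeas hp X -> _]eq_fun do rewrite mul1r.
have form2 (d0 : measure_display) (T0 : measurableType d0) (Z2 Z3 Z4 : T0 -> QpM p) :
    measurable_fun setT Z2 -> measurable_fun setT Z3 -> measurable_fun setT Z4 ->
    levmeas hp (fun t => b2 * (Z2 t : K) + b3 * (Z3 t : K) + (Z4 t : K)).
  move=> k2 k3 k4; have := levmeas_linear_form b2 b3 1 k2 k3 k4.
  by under [X in levmeas hp X -> _]eq_fun do rewrite mul1r.
have := cexp_joint_law u v (form1 _ _ _ _ _ mY1 mY2 mY3) (form2 _ _ _ _ _ mY2 mY3 mY4)
  (form1 _ _ _ _ _ mX1 mX2 mX3) (form2 _ _ _ _ _ mX2 mX3 mX4) law.
rewrite (cexp_linear_forms a2 a3 b2 b3 u v mY1 mY2 mY3 mY4 iY).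
rewrite (cexp_linear_forms a2 a3 b2 b3 u v mX1 mX2 mX3 mX4 iX) => E.
have nz X : measurable_fun setT X -> charfun_nonvanishing P X -> forall y, cfun hp P X y != 0.
  by move=> mX; exact: cfun_neq0 (measurable_levmeas hp mX).
have frac (x1 x2 x3 x4 y1 y2 y3 y4 : R[i]) :
  y1 / x1 * (y2 / x2) * (y3 / x3) * (y4 / x4) = y1 * y2 * y3 * y4 / (x1 * x2 * x3 * x4).
  by rewrite !invfM; ring.
rewrite /cfratio frac E divff //.
exact: (mulf_neq0 (mulf_neq0 (mulf_neq0 (nz _ mX1 n1 _) (nz _ mX2 n2 _)) (nz _ mX3 n3 _)) (nz _ mX4 n4 _)).
Qed.

End Determination.

Arguments cfratio {R p} hp {d d' T T'} P P' X Y y.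

Unset Implicit Arguments. Set Strict Implicit. Set Printing Implicit Defensive.

Theorem theorem3p2 (R : realType) (p : nat) (hp : prime p)
  (a2 a3 b2 b3 : Qp p)
  (ha2 : a2 <> qzero p) (ha3 : a3 <> qzero p)
  (hb2 : b2 <> qzero p) (hb3 : b3 <> qzero p)
  (d : measure_display) (T : measurableType d) (P : probability T R)
  (xi1 xi2 xi3 xi4 : T -> QpM p)
  (mxi1 : measurable_fun setT xi1) (mxi2 : measurable_fun setT xi2)
  (mxi3 : measurable_fun setT xi3) (mxi4 : measurable_fun setT xi4)
  (ind_xi : indep4 P xi1 xi2 xi3 xi4)
  (cf1 : charfun_nonvanishing P xi1) (cf2 : charfun_nonvanishing P xi2)
  (cf3 : charfun_nonvanishing P xi3) (cf4 : charfun_nonvanishing P xi4) :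
  let L1 := fun t => qadd (qadd (xi1 t) (qmul a2 (xi2 t))) (qmul a3 (xi3 t)) : QpM p in
  let L2 := fun t => qadd (qadd (qmul b2 (xi2 t)) (qmul b3 (xi3 t))) (xi4 t) : QpM p in
  (* (I) *)
  (qmul a2 b3 <> qmul a3 b2 ->
   forall (d' : measure_display) (T' : measurableType d') (P' : probability T' R)
     (eta1 eta2 eta3 eta4 : T' -> QpM p),
   measurable_fun setT eta1 -> measurable_fun setT eta2 ->
   measurable_fun setT eta3 -> measurable_fun setT eta4 ->
   indep4 P' eta1 eta2 eta3 eta4 ->
   charfun_nonvanishing P' eta1 -> charfun_nonvanishing P' eta2 ->
   charfun_nonvanishing P' eta3 -> charfun_nonvanishing P' eta4 ->
   let M1 := fun t => qadd (qadd (eta1 t) (qmul a2 (eta2 t))) (qmul a3 (eta3 t)) : QpM p in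
   let M2 := fun t => qadd (qadd (qmul b2 (eta2 t)) (qmul b3 (eta3 t))) (eta4 t) : QpM p in
   same_law P' (fun t => (M1 t, M2 t) : QpM p * QpM p) P (fun t => (L1 t, L2 t)) ->
   exists alpha1 alpha2 alpha3 alpha4 : Qp p,
     same_law P' eta1 P (fun t => qadd (xi1 t) alpha1 : QpM p) /\
     same_law P' eta2 P (fun t => qadd (xi2 t) alpha2 : QpM p) /\
     same_law P' eta3 P (fun t => qadd (xi3 t) alpha3 : QpM p) /\
     same_law P' eta4 P (fun t => qadd (xi4 t) alpha4 : QpM p))
  /\
  (* (II) *)
  (qmul a2 b3 = qmul a3 b2 -> qnorm a2 <> qnorm a3 -> same_law P xi2 P xi3 ->
   forall (d' : measure_display) (T' : measurableType d') (P' : probability T' R)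
     (eta1 eta2 eta3 eta4 : T' -> QpM p),
   measurable_fun setT eta1 -> measurable_fun setT eta2 ->
   measurable_fun setT eta3 -> measurable_fun setT eta4 ->
   indep4 P' eta1 eta2 eta3 eta4 ->
   charfun_nonvanishing P' eta1 -> charfun_nonvanishing P' eta2 ->
   charfun_nonvanishing P' eta3 -> charfun_nonvanishing P' eta4 ->
   same_law P' eta2 P' eta3 ->
   let M1 := fun t => qadd (qadd (eta1 t) (qmul a2 (eta2 t))) (qmul a3 (eta3 t)) : QpM p in
   let M2 := fun t => qadd (qadd (qmul b2 (eta2 t)) (qmul b3 (eta3 t))) (eta4 t) : QpM p in
   same_law P' (fun t => (M1 t, M2 t) : QpM p * QpM p) P (fun t => (L1 t, L2 t)) ->
   exists alpha1 alpha2 alpha3 alpha4 : Qp p,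
     same_law P' eta1 P (fun t => qadd (xi1 t) alpha1 : QpM p) /\
     same_law P' eta2 P (fun t => qadd (xi2 t) alpha2 : QpM p) /\
     same_law P' eta3 P (fun t => qadd (xi3 t) alpha3 : QpM p) /\
     same_law P' eta4 P (fun t => qadd (xi4 t) alpha4 : QpM p)).

Proof.
move=> L1 L2.
have neq0 (x : Qp p) : x <> qzero p -> (x : Qpf hp) != 0 by move=> h; apply/eqP.
have A2 := neq0 a2 ha2; have A3 := neq0 a3 ha3.
have B2 := neq0 b2 hb2; have B3 := neq0 b3 hb3.
split=> [det|det norm23 law23] d' T' P' eta1 eta2 eta3 eta4 meta1 meta2 meta3 meta4
  ind_eta ce1 ce2 ce3 ce4.
  move=> M1 M2 law.
  have E := @cfratio_equation R p hp d d' T T' P P' xi1 xi2 xi3 xi4 eta1 eta2 eta3 eta4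
    a2 a3 b2 b3 mxi1 mxi2 mxi3 mxi4 ind_xi cf1 cf2 cf3 cf4 meta1 meta2 meta3 meta4 ind_eta law.
  have D : (a2 : Qpf hp) * (b3 : Qpf hp) != (a3 : Qpf hp) * (b2 : Qpf hp) by apply/eqP.
  have [c1 c2 c3 c4] := char_of_independent_forms (cfratio_cflike hp mxi1 meta1 cf1 ce1)
    (cfratio_cflike hp mxi2 meta2 cf2 ce2) (cfratio_cflike hp mxi3 meta3 cf3 ce3)
    (cfratio_cflike hp mxi4 meta4 cf4 ce4) A2 A3 B2 B3 D E.
  have [s1 h1] := cfratio_shift mxi1 meta1 cf1 c1.
  have [s2 h2] := cfratio_shift mxi2 meta2 cf2 c2.
  have [s3 h3] := cfratio_shift mxi3 meta3 cf3 c3.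
  have [s4 h4] := cfratio_shift mxi4 meta4 cf4 c4.
  by exists s1, s2, s3, s4.
move=> law23' M1 M2 law.
have E := @cfratio_equation R p hp d d' T T' P P' xi1 xi2 xi3 xi4 eta1 eta2 eta3 eta4
  a2 a3 b2 b3 mxi1 mxi2 mxi3 mxi4 ind_xi cf1 cf2 cf3 cf4 meta1 meta2 meta3 meta4 ind_eta law.
(* Equality in law within each pair makes numerators and denominators agree, so a single function
   plays both middle roles in the functional equation. *)
have e23 : cfratio hp P P' xi3 eta3 = cfratio hp P P' xi2 eta2.
  apply/funext => y; rewrite /cfratio.
  by rewrite (same_law_cfun y mxi2 mxi3 law23) (same_law_cfun y meta2 meta3 law23').
pose Q (g : Qpf hp -> R[i]) := forall u v : Qpf hp, cfratio hp P P' xi1 eta1 u *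
  cfratio hp P P' xi2 eta2 ((a2 : Qpf hp) * u + (b2 : Qpf hp) * v) *
  g ((a3 : Qpf hp) * u + (b3 : Qpf hp) * v) * cfratio hp P P' xi4 eta4 v = 1.
(* [Q] isolates the third factor, so that only this occurrence is replaced. *)
have E' : Q (cfratio hp P P' xi2 eta2) := eq_ind _ Q E _ e23.
have [c1 c2 c4] := char_of_dependent_forms (cfratio_cflike hp mxi1 meta1 cf1 ce1)
  (cfratio_cflike hp mxi2 meta2 cf2 ce2) (cfratio_cflike hp mxi4 meta4 cf4 ce4)
  A2 A3 B2 det (qnorm_neq ha2 ha3 norm23) E'.
have c3 : is_char (cfratio hp P P' xi3 eta3) := eq_ind_r (fun g => is_char g) c2 e23.
have [s1 h1] := cfratio_shift mxi1 meta1 cf1 c1.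
have [s2 h2] := cfratio_shift mxi2 meta2 cf2 c2.
have [s3 h3] := cfratio_shift mxi3 meta3 cf3 c3.
have [s4 h4] := cfratio_shift mxi4 meta4 cf4 c4.
by exists s1, s2, s3, s4.
Qed.
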